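(* Let $p=1-q\in(0,1/2)$. Let $\gamma\in\mathcal P_0(\mathbb R^{\mathbb Z})$ and let $x=\{x_i\}_{i\in\mathbb Z}\sim\gamma$. Assume that, $\gamma$-almost surely, $$\limsup_{M\to\infty}\frac{-x_{-M}}{\sqrt M}=\infty .$$ For a solution $(X,L)$ of the bi-infinite system with parameter $p$, consider the property $$(\mathrm{LT})\qquad \forall\, T\in[0,\infty):\quad \limsup_{M\to\infty}\Big(\frac qp\Big)^{-M}L_{(-M,-M+1)}(T)=0\ \text{ a.s.}$$ Then solutions of the bi-infinite system with parameter $p$ and initial distribution $\gamma$ are pathwise unique among all solutions whose local times satisfy $(\mathrm{LT})$.
   Context: $\mathcal P_0(\mathbb R^{\mathbb Z})$ is the set of probability measures on $\mathbb R^{\mathbb Z}$ under which a.e. $z=\{z_i\}$ satisfies $z_i\le z_{i+1}$ for all $i\in\mathbb Z$. Bi-infinite system. Let $(\Omega,\mathcal F,\{\mathcal F_t\}_{t\ge0},\mathbb P)$ be a filtered probability space carrying independent standard $\{\mathcal F_t\}$-Brownian motions $\{B_i\}_{i\in\mathbb Z}$ (adapted, and $\{B_i(t+\cdot)-B_i(t)\}_{i\in\mathbb Z}$ is independent of $\mathcal F_t$ for all $t\ge 0$) and a nondecreasing sequence $x=\{x_i\}_{i\in\mathbb Z}$ of $\mathcal F_0$-measurable random variables. A solution with parameter $p=1-q$, initial condition $x$ and driving Brownian motions $\{B_i\}$ is a pair $(X,L)$ of collections $X=\{X_i(t),t\ge0\}_{i\in\mathbb Z}$, $L=\{L_{(i,i+1)}(t),t\ge0\}_{i\in\mathbb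 Z}$ of continuous real-valued $\{\mathcal F_t\}$-adapted processes such that: (1) $X_i(t)=x_i+B_i(t)+pL_{(i-1,i)}(t)-qL_{(i,i+1)}(t)$ for all $t\ge0$, $i\in\mathbb Z$; (2) for all $t\ge0$ the sequence $\{X_i(t)\}_{i\in\mathbb Z}$ is nondecreasing; (3) each $L_{(i,i+1)}$ is nondecreasing, $L_{(i,i+1)}(0)=0$, and $\int_0^\infty (X_{i+1}(t)-X_i(t))\,dL_{(i,i+1)}(t)=0$. Solutions are pathwise unique for the initial distribution $\gamma$ among solutions satisfying a property $(\mathcal P)$ if, for any filtered probability space $(\Omega,\mathcal F,\{\mathcal F_t\}_{t\ge0},\mathbb P)$, any independent standard $\{\mathcal F_t\}$-Brownian motions $\{B_i\}_{i\in\mathbb Z}$ on it (adapted, with $\{B_i(t+\cdot)-B_i(t)\}_{i\in\mathbb Z}$ independent of $\mathcal F_t$ for all $t\ge0$) and any nondecreasing sequence $x=\{x_i\}_{i\in\mathbb Z}$ of $\mathcal F_0$-measurable random variables with $x\sim\gamma$, any two solutions $(X,L)$ and $(X',L')$ on it with the same $x$ and $\{B_i\}$, both satisfying $(\mathcal P)$, are almost surely equal: $X=X'$ and $L=L'$. *)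

(* Defs.v *)
From HB Require Import structures.
From mathcomp Require Import all_boot all_order all_algebra.
From mathcomp Require Import all_classical all_reals all_analysis.

Set Implicit Arguments.
Unset Strict Implicit.
Unset Printing Implicit Defensive.

Import Order.TTheory GRing.Theory Num.Theory.
Import numFieldNormedType.Exports.

Local Open Scope classical_set_scope.
Local Open Scope ring_scope.

Definition coordinate_cylinders (R : realType) : set (set (int -> R)) :=
  [set C | exists (i : int) (A : set R),
     measurable A /\ C = [set z : int -> R | A (z i)]].

(* R^Z with its product sigma-algebra *)
Definition seqR (R : realType) := g_sigma_algebraType (@coordinate_cylinders R).

Definition P0 (R : realType) : set (probability (seqR R) R) :=
  [set g : probability (seqR R) R |
     {ae g, forall z : seqR R, forall i : int, z i <= z (i + 1)}].

Section probability_notions.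
Context (d : measure_display) (Omega : measurableType d) (R : realType).
Variable P : probability Omega R.

Definition sigma_of (I : Type) (D : set I) (Y : I -> Omega -> R) :
    set (set Omega) :=
  <<s \bigcup_(i in D)
        preimage_set_system setT (Y i) (@measurable _ (measurableTypeR R)) >>.

Definition independent (G H : set (set Omega)) :=
  forall A B, G A -> H B -> P (A `&` B) = (P A * P B)%E.

Definition mutually_independent (I : eqType) (G : I -> set (set Omega)) :=
  forall (s : seq I) (A : I -> set Omega), uniq s ->
    (forall i, i \in s -> G i (A i)) ->
    P (\bigcap_(i in [set` s]) A i) = (\prod_(i <- s) P (A i))%E.

Definition measurable_wrt (G : set (set Omega)) (Y : Omega -> R) :=
  forall A : set R, measurable A -> G (Y @^-1` A).

(* Time is [0, +oo[; values at negative times are never used. *)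
Definition filtration (F : R -> set (set Omega)) :=
  [/\ (forall t : R, 0 <= t -> sigma_algebra setT (F t)),
      (forall t : R, 0 <= t -> F t `<=` measurable) &
      (forall s t : R, 0 <= s -> s <= t -> F s `<=` F t)].

Definition adapted (F : R -> set (set Omega)) (Y : R -> Omega -> R) :=
  forall t : R, 0 <= t -> measurable_wrt (F t) (Y t).

(* Path properties hold almost surely; this includes the case where they hold
   for every w. The second parameter of normal_prob is the standard deviation. *)
Definition standard_brownian_motion (B : R -> Omega -> R) :=
  [/\ (forall t : R, 0 <= t -> measurable_fun setT (B t)),
      (\forall w \ae P,
         B 0 w = 0 /\ {within `[0, +oo[, continuous (fun t => B t w)}),
      (forall s t : R, 0 <= s -> s < t -> forall A : set R, measurable A ->
         P [set w | A (B t w - B s w)] = normal_prob 0 (Num.sqrt (t - s)) A) &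
      (forall t : nat -> R, 0 <= t 0%N -> (forall k, t k <= t k.+1) ->
         mutually_independent (fun k : nat =>
           g_sigma_algebra_preimage (fun w => B (t k.+1) w - B (t k) w)))].

Definition independent_brownian_motions (F : R -> set (set Omega))
    (B : int -> R -> Omega -> R) :=
  [/\ (forall i, standard_brownian_motion (B i)),
      mutually_independent (fun i => sigma_of [set t : R | 0 <= t] (B i)),
      (forall i, adapted F (B i)) &
      (forall t : R, 0 <= t -> independent (F t)
         (sigma_of [set k : int * R | 0 <= k.2]
            (fun k w => B k.1 (t + k.2) w - B k.1 t w)))].

Definition has_law (x : int -> Omega -> R) (g : probability (seqR R) R) :=
  forall A : set (seqR R), measurable A ->
    P (((fun w i => x i w) : Omega -> seqR R) @^-1` A) = g A.

End probability_notions.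

(* The integral of f over [0, +oo[ against dl vanishes, for l : [0, +oo[ -> R
   nondecreasing and right-continuous; l is extended by l 0 to the left of 0. *)
Definition stieltjes_integral_zero (R : realType) (f l : R -> R) :=
  exists2 G : cumulative R R, (forall t, G t = l (Num.max 0 t)) &
    (\int[lebesgue_stieltjes_measure G]_(t in `[0%R, +oo[) (f t)%:E = 0)%E.

(* L i stands for L_(i, i+1). *)
Definition solution_path (R : realType) (p q : R)
    (x : int -> R) (B X L : int -> R -> R) :=
  [/\ (forall i, {within `[0, +oo[, continuous (X i)}) /\
      (forall i, {within `[0, +oo[, continuous (L i)}),
      (forall (i : int) (t : R), 0 <= t -> X i t = x i + B i t + p * L (i - 1) t - q * L i t),
      (forall t : R, 0 <= t -> forall i, X i t <= X (i + 1) t) &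
      (forall i,
         [/\ (forall s t : R, 0 <= s -> s <= t -> L i s <= L i t),
             L i 0 = 0 &
             stieltjes_integral_zero (fun t => X (i + 1) t - X i t) (L i)])].

(* As for Brownian motions, the conditions on paths hold almost surely. *)
Definition solution (d : measure_display) (Omega : measurableType d)
    (R : realType) (P : probability Omega R) (F : R -> set (set Omega))
    (p q : R) (x : int -> Omega -> R) (B X L : int -> R -> Omega -> R) :=
  [/\ (forall i, adapted F (X i)),
      (forall i, adapted F (L i)) &
      (\forall w \ae P, solution_path p q (x^~ w) (fun i t => B i t w)
         (fun i t => X i t w) (fun i t => L i t w))].

Definition pathwise_unique (R : realType) (p q : R)
    (g : probability (seqR R) R)
    (prop : forall (d : measure_display) (Omega : measurableType d),
       probability Omega R ->
       (int -> R -> Omega -> R) -> (int -> R -> Omega -> R) -> Prop) :=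
  forall (d : measure_display) (Omega : measurableType d)
    (P : probability Omega R) (F : R -> set (set Omega))
    (B : int -> R -> Omega -> R) (x : int -> Omega -> R),
  filtration F ->
  independent_brownian_motions P F B ->
  (forall i, measurable_wrt (F 0) (x i)) ->
  (\forall w \ae P, forall i : int, x i w <= x (i + 1) w) ->
  has_law P x g ->
  forall X L X' L' : int -> R -> Omega -> R,
  solution P F p q x B X L -> prop d Omega P X L ->
  solution P F p q x B X' L' -> prop d Omega P X' L' ->
  \forall w \ae P, forall (i : int) (t : R), 0 <= t ->
    X i t w = X' i t w /\ L i t w = L' i t w.

Definition LT (R : realType) (p q : R) (d : measure_display)
    (Omega : measurableType d) (P : probability Omega R)
    (X L : int -> R -> Omega -> R) :=
  forall T : R, 0 <= T -> \forall w \ae P,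
    limn_esup (fun M : nat => ((q / p) ^- M * L (- M%:Z) T w)%:E) = 0%E.

(* Main.v *)
(* Put Delta_i = X_i - X'_i and rho = p / q < 1.  In the sums of
   rho^(m - i) phi(Delta_i) over i <= m, with phi convex, collisions can only
   produce decrease, up to the flux at both ends; the flux at -oo vanishes by (LT)
   and positive discrepancies enter at m only when L'_m grows.  Hence, if
   X'_n < X_n at some time in [0, T], following X' backwards from one last contact
   to the next yields times t = t_0 >= t_1 >= ... >= 0 with
   X'_(n+N)(t_N) <= X'_n(t) + (Brownian increments along the path) for all N, and
   the increments along such a path are at most C sqrt(N T), uniformly over paths.
   On the other hand averages of X'_n, ..., X'_(n+k) with geometric weights can
   increase only through the Brownian motions and L'_(n-1), and are monotone in k.
   Descending from n + N at time T to n at time T + tau along a path which picks the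
   favourable one of two neighbours on each of N / 2 time blocks gains
   - kappa sqrt(N tau), so that
   X'_n(T + tau) <= X'_(n+N)(t_N) + C sqrt(N T) - kappa sqrt(N tau) + O(1).  For tau
   large and N -> oo this contradicts the finiteness of X'_n(T + tau). *)
Require Import Defs.
From HB Require Import structures.
From mathcomp Require Import all_boot all_order all_algebra.
From mathcomp Require Import all_classical all_reals all_analysis.
From mathcomp Require Import measurable_realfun.
From mathcomp Require Import ring lra zify.

Set Implicit Arguments.
Unset Strict Implicit.
Unset Printing Implicit Defensive.

Import Order.TTheory GRing.Theory Num.Theory.
Import numFieldNormedType.Exports.
Import HBNNSimple.

Local Open Scope classical_set_scope.
Local Open Scope ring_scope.

(** * Contacts and local times *)

(** (LT) speaks of the left end only. The obstacle is the right end: comparison of finitely many or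
    of half-infinitely many particles breaks down where L'_m feeds a discrepancy in, so a
    discrepancy is excluded by showing that it would have to come from +oo along an impossible path.
    That path depends on the solutions and on the whole trajectories. Therefore the two facts about
    the noise, [path_noise_bounded] and [descending_gain], mention B alone, the first one uniformly
    over paths; everything about solutions is then deterministic, for a fixed w. The order of the
    constants is essential: C depends on T only, whereas tau is chosen afterwards, and the descent
    takes place in the extra time [T, T + tau], so that its gain grows with tau at no further cost
    in noise. The ratio p / q is forced: X_i gains p L_(i-1) and loses q L_i, and with these
    geometric weights each interior local time meets itself with equal weight. Equality of the
    positions still leaves the local times: it determines their differences up to a geometric
    sequence, which (LT) makes zero. *)

Definition nonneg_continuous (R : realType) (f : R -> R) :=
  forall u e : R, 0 <= u -> 0 < e -> exists2 d, 0 < d &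
    forall v, 0 <= v -> `|v - u| < d -> `|f v - f u| < e.

Lemma within_nonneg_continuous (R : realType) (f : R -> R) :
  {within `[0, +oo[, continuous f} -> nonneg_continuous f.
Proof.
move=> cf u e u0 e0.
have u0' : `[0, +oo[%classic u by rewrite /= in_itv/= andbT.
have /cvgrPdist_lt /(_ _ e0) := (subspace_continuousP _ _).1 cf u u0'.
rewrite near_withinE => -[d /= d0 H]; exists d => // v v0 vu.
rewrite distrC; apply: H; first by rewrite /ball_ /= distrC.
by rewrite /= in_itv/= andbT.
Qed.

(** A nonnegative function with zero integral vanishes almost everywhere for dl, so []a, b]] is a
    null set, and its mass is [l b - l a]. The point [a] is left out because it will be a contact
    time. *)
Lemma stieltjes_integral_zero_flat (R : realType) (f l : R -> R) :
  {within `[0, +oo[, continuous f} -> (forall t : R, 0 <= t -> 0 <= f t) ->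
  stieltjes_integral_zero f l ->
  forall a b : R, 0 <= a -> a <= b -> (forall t : R, a < t <= b -> 0 < f t) ->
  l a = l b.
Proof.
move=> cf f0 [G Gl If0] a b a0; rewrite le_eqVlt => /predU1P[-> //|ab fab].
pose mu : {measure set (measurableTypeR R) -> \bar R} :=
  lebesgue_stieltjes_measure G.
have mI : measurable (`[0, +oo[%classic : set (measurableTypeR R)).
  exact: measurable_itv.
have mf : measurable_fun (`[0, +oo[%classic : set (measurableTypeR R))
    (EFin \o f).
  apply/measurable_EFinP; 
  exact: measurable_realfun.subspace_continuous_measurable_fun.
have : (\int[mu]_(x in `[0%R, +oo[) `|(f x)%:E| = 0)%E.
  rewrite -[RHS]If0; apply: eq_integral => x; rewrite inE/= in_itv/= andbT => x0.
  by rewrite ger0_norm// f0.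
move=> /(ae_eq_integral_abs mu mI mf) [N [mN N0 HN]].
have muab : mu `]a, b]%classic = (l b - l a)%:E.
  rewrite /mu/= /lebesgue_stieltjes_measure /measure_extension.
  rewrite measurable_mu_extE/=; last exact: is_ocitv.
  rewrite wlength_itv_bnd//; last exact: ltW.
  by rewrite !Gl !max_r// (le_trans a0)// ltW.
have sub : `]a, b]%classic `<=` N.
  move=> t; rewrite /= in_itv/= => tab; apply: HN => /= H.
  have t0 : 0 < t by case/andP: tab => /(le_lt_trans a0).
  have : t \in `[0, +oo[ by rewrite in_itv/= andbT ltW.
  by move=> /H [ft]; have := fab _ tab; rewrite ft ltxx.
have : ((l b - l a)%:E <= 0)%E.
  rewrite -muab -N0; apply: le_measure; rewrite ?inE//; exact: measurable_itv.
rewrite lee_fin subr_le0 => ba; apply/eqP; rewrite eq_le ba andbT.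
by rewrite -subr_ge0 -lee_fin -muab.
Qed.

Lemma last_zero (R : realType) (f : R -> R) (t : R) :
  nonneg_continuous f ->
  (exists2 s, 0 <= s <= t & f s = 0) ->
  exists2 s, 0 <= s <= t & f s = 0 /\ forall v, s < v <= t -> f v != 0.
Proof.
move=> cf [s0 s0t fs0].
pose S := [set s | 0 <= s <= t /\ f s = 0].
have supS : has_sup S.
  by split; [exists s0 | exists t => s [/andP[]]].
have S0 : 0 <= sup S.
  have /andP[s00 _] := s0t; apply: le_trans s00 _.
  exact: (sup_upper_bound supS).
have St : sup S <= t by apply: ge_sup; [exact: supS.1 | move=> s [/andP[]]].
exists (sup S); first by rewrite S0 St.
split; last first.
  move=> v /andP[Sv vt]; apply/eqP => fv.
  have : v <= sup S.
    apply: (sup_upper_bound supS).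
    by split => //; rewrite vt andbT (le_trans S0) ?ltW.
  by rewrite leNgt Sv.
apply/eqP; apply: contraT => fS.
have [d d0 H] := cf _ `|f (sup S)| S0 ltac:(by rewrite normr_gt0).
have [v Sv vS] := sup_adherent d0 supS.
have vs : v <= sup S by exact: (sup_upper_bound supS).
case: Sv => /andP[v0 vt] fv.
have := H v v0; rewrite fv sub0r normrN ltxx; apply.
by rewrite ler0_norm ?subr_le0// opprB ltrBlDr -ltrBlDl.
Qed.

(** At the supremum of the times [t] with [H t <= H a], the local hypothesis compares a time just
    before with one just after, so the supremum can only be [b]. *)
Lemma local_nonincreasing (R : realType) (H : R -> R) (a b : R) : a <= b ->
  (forall u, a <= u <= b -> exists2 d, 0 < d &
    forall s t, a <= s -> s <= t -> t <= b -> `|s - u| < d -> `|t - u| < d ->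
      H t <= H s) ->
  H b <= H a.
Proof.
move=> ab loc.
pose S := [set t | a <= t <= b /\ H t <= H a].
have Sa : S a by split; rewrite ?lexx// ab.
have supS : has_sup S by split; [exists a | exists b => s [/andP[]]].
have S0 : a <= sup S by exact: (sup_upper_bound supS).
have St : sup S <= b by apply: ge_sup; [exact: supS.1 | move=> s [/andP[]]].
have [d d0 {}loc] := loc (sup S) ltac:(by rewrite S0 St).
have [v Sv vS] := sup_adherent d0 supS.
have vs : v <= sup S by exact: (sup_upper_bound supS).
case: Sv => /andP[av vb] Hv.
pose w := Num.min b (sup S + d / 2).
have sw : sup S <= w by rewrite /w le_min St lerDl divr_ge0// ltW.
have wb : w <= b by rewrite /w ge_min lexx.
have Sw : S w.
  split; first by rewrite wb andbT (le_trans S0).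
  apply: le_trans Hv; apply: loc => //; first exact: le_trans sw.
    by rewrite ler0_norm ?subr_le0// opprB ltrBlDr -ltrBlDl.
  rewrite ger0_norm ?subr_ge0// ltrBlDl (@le_lt_trans _ _ (sup S + d / 2))//.
    by rewrite /w ge_min lexx orbT.
  by rewrite ltrD2l gtr_pMr// invf_lt1// ltr1n.
have ws : w <= sup S by exact: (sup_upper_bound supS).
case: Sw => _; suff -> : w = b by [].
move: ws; rewrite /w minElt; case: ifPn => // _.
by rewrite gerDl leNgt divr_gt0.
Qed.

Lemma path_contact (R : realType) (p q : R) x (B X L : int -> R -> R) :
  solution_path p q x B X L -> forall (i : int) (a b : R),
  0 <= a -> a <= b -> L i a != L i b ->
  exists2 c, a <= c <= b & X (i + 1) c = X i c.
Proof.
move=> [[cX cL] _ ord con] i a b a0 ab; apply: contraNP => nc; apply/eqP.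
have [_ _ sz] := con i.
apply: (stieltjes_integral_zero_flat _ _ sz) => //.
- by move=> z; apply: continuousB; exact: cX.
- by move=> t t0; rewrite subr_ge0 ord.
move=> t /andP[at_ tb]; have t0 : 0 <= t by rewrite (le_trans a0)// ltW.
rewrite lt_neqAle subr_ge0 ord// andbT eq_sym subr_eq0; apply/eqP => e.
by apply: nc; exists t; rewrite ?tb ?andbT ?ltW.
Qed.

Lemma path_last_contact (R : realType) (p q : R) x (B X L : int -> R -> R) :
  solution_path p q x B X L -> forall (i : int) (t : R), 0 <= t ->
  L i t = 0 \/ exists2 s, 0 <= s <= t & X (i + 1) s = X i s /\ L i s = L i t.
Proof.
move=> sol i t t0; have [[cX cL] _ ord con] := sol.
have [_ L0 sz] := con i.
pose f := fun t => X (i + 1) t - X i t.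
have cf : {within `[0, +oo[, continuous f}.
  by move=> z; apply: continuousB; exact: cX.
have f0 (u : R) : 0 <= u -> 0 <= f u by move=> u0; rewrite subr_ge0 ord.
have [[s st fs]|no] := pselect (exists2 s, 0 <= s <= t & f s = 0); last first.
  left; apply/eqP; apply: contrapT => /negP Lt; apply: no.
  have [|c ct ec] := path_contact (i := i) sol (lexx 0) t0; first by rewrite L0 eq_sym.
  by exists c => //; rewrite /f ec subrr.
right; have [s' s't [fs' gs']] := last_zero (within_nonneg_continuous cf) (ex_intro2 _ _ s st fs).
exists s' => //; split; first by apply/eqP; rewrite -subr_eq0; apply/eqP.
have /andP[s0 s't'] := s't.
apply: (stieltjes_integral_zero_flat cf f0 sz) => // v /andP[sv vt].
by rewrite lt_neqAle eq_sym gs' ?sv// f0// (le_trans s0)// ltW.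
Qed.

(** * A convex test function and its weighted flux *)

(** Derivative of the test function. It vanishes on nonpositive arguments, so that only
    discrepancies X > X' count; it is at most 1, which bounds the flux at the left end by a local
    time; it is 1-Lipschitz, which turns small displacements into small errors. *)
Definition clamp (R : realType) (x : R) := Num.min (Num.max x 0) 1.

(* Primitive of [clamp]. *)
Definition huber (R : realType) (x : R) := clamp x * x - clamp x ^+ 2 / 2.

Lemma clampP (R : realType) (x : R) :
  [\/ [/\ x <= 0, x <= 0 & clamp x = 0], [/\ 0 < x, x <= 1 & clamp x = x]
    | [/\ 0 < x, 1 < x & clamp x = 1]].
Proof.
rewrite /clamp; case: (leP x 0) => x0; first by constructor 1; rewrite min_l.
by case: (leP x 1) => x1; [constructor 2 | constructor 3].
Qed.

Lemma clamp_bounds (R : realType) (x : R) : 0 <= clamp x <= 1.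
Proof. by case: (clampP x) => -[? ? ->]; lra. Qed.

Lemma clamp_lip (R : realType) (x y e : R) : 0 <= e -> x <= y + e ->
  clamp x <= clamp y + e.
Proof.
by move=> e0 xy; case: (clampP x) => -[? ? ->]; case: (clampP y) => -[? ? ->]; lra.
Qed.

Lemma huber_le (R : realType) (x y : R) :
  huber y - huber x <= clamp y * (y - x).
Proof.
rewrite /huber; have := sqr_ge0 (y - x).
by case: (clampP x) => -[? ? ->]; case: (clampP y) => -[? ? ->]; nra.
Qed.

Lemma huber_le0 (R : realType) (x : R) : x <= 0 -> huber x = 0.
Proof. by move=> x0; rewrite /huber; case: (clampP x) => -[? ? ->]; lra. Qed.

Lemma huber_ge0 (R : realType) (x : R) : 0 <= huber x.
Proof. by rewrite /huber; case: (clampP x) => -[? ? ->]; nra. Qed.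

Lemma huber_gt0 (R : realType) (x : R) : 0 < x -> 0 < huber x.
Proof. by move=> x0; rewrite /huber; case: (clampP x) => -[? ? ->]; nra. Qed.

Lemma finite_radius (R : realType) (P : nat -> R -> Prop) (n : nat) :
  (forall k, exists2 d, 0 < d & forall d', d' <= d -> P k d') ->
  exists2 d, 0 < d & forall k, (k < n)%N -> P k d.
Proof.
move=> H; suff [d d0 h] : exists2 d, 0 < d & forall k, (k < n)%N ->
    forall d', d' <= d -> P k d'.
  by exists d => // k kn; exact: h kn _ _.
elim: n => [|n [d d0 IH]]; first by exists 1.
have [e e0 He] := H n.
exists (Num.min d e); first by rewrite lt_min d0.
move=> k; rewrite ltnS leq_eqVlt => /predU1P[->|kn] d'; rewrite le_min => /andP[dd de].
  exact: He.
exact: IH.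
Qed.

(** Summation by parts, with p = q r and sites numbered from right to left: the flux k+1 enters term
    k with weight q r^(k+1) and leaves term k+1 with the same weight. Inside, only the differences
    of [psi] remain. *)
Lemma weighted_flux_le (R : realType) (q r e : R) (psi l l' : nat -> R) (M : nat) :
  0 <= q -> 0 <= r -> r <= 1 ->
  (forall k, (k < M)%N -> (psi k - psi k.+1) * (l k.+1 - l' k.+1) <= e * (l k.+1 + l' k.+1)) ->
  (forall k, 0 <= e * (l k.+1 + l' k.+1)) ->
  \sum_(k < M.+1) r ^+ k * (psi k * (q * r * (l k.+1 - l' k.+1) - q * (l k - l' k))) <=
  - q * psi 0%N * (l 0%N - l' 0%N) + q * r ^+ M.+1 * psi M * (l M.+1 - l' M.+1)
  + q * e * \sum_(k < M) (l k.+1 + l' k.+1).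
Proof.
move=> q0 r0 r1; elim: M => [|M IH] H H0.
  by rewrite big_ord_recr/= !big_ord0; lra.
rewrite big_ord_recr/=.
have {}IH := IH (fun k kM => H k (ltnW kM)) H0.
apply: le_trans; first by apply: lerD; [exact: IH|exact: lexx].
rewrite [in leRHS]big_ord_recr/=.
have rM0 : 0 <= r ^+ M.+1 by exact: exprn_ge0.
have rM1 : r ^+ M.+1 <= 1 by exact: exprn_ile1.
have := H M (ltnSn _); have := H0 M.
rewrite [r ^+ M.+2]exprSr.
move: (\sum_(_ < _) _) (r ^+ M.+1) rM0 rM1
  (l M.+1) (l' M.+1) (psi M) (psi M.+1)
  (l M.+2) (l' M.+2) => S c c0 c1 a a' s s' b b' h0 h.
have : q * c * ((s - s') * (a - a')) <= q * (e * (a + a')).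
  rewrite -mulrA; apply: ler_wpM2l => //.
  have : c * ((s - s') * (a - a')) <= c * (e * (a + a')) by exact: ler_wpM2l.
  by move=> h1; apply: le_trans h1 _; rewrite -[leRHS]mul1r ler_wpM2r.
by nra.
Qed.

(** * Weighted contraction *)

Lemma subSzDr1 (m : int) (k : nat) : m - k.+1%:Z + 1 = m - k%:Z.
Proof. lia. Qed.

Lemma subzBr1 (m : int) (k : nat) : m - k%:Z - 1 = m - k.+1%:Z.
Proof. lia. Qed.

Lemma solution_path_increment (R : realType) (p q : R) x (B X L X' L' : int -> R -> R) :
  solution_path p q x B X L -> solution_path p q x B X' L' ->
  forall (i : int) (s t : R), 0 <= s -> 0 <= t ->
  (X i t - X' i t) - (X i s - X' i s) =
  p * ((L (i - 1) t - L (i - 1) s) - (L' (i - 1) t - L' (i - 1) s))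
  - q * ((L i t - L i s) - (L' i t - L' i s)).
Proof.
by move=> [_ e _ _] [_ e' _ _] i s t s0 t0; rewrite !e ?e'//; ring.
Qed.

Definition huber_energy (R : realType) (r : R) (X X' : int -> R -> R) (m : int)
    (M : nat) (t : R) :=
  \sum_(k < M.+1) r ^+ k * huber (X (m - k%:Z) t - X' (m - k%:Z) t).

(* By convexity, huber y - huber x <= clamp y * (y - x).  In the weighted sum
   the increment of L_i only multiplies clamp Delta_(i+1) - clamp Delta_i
   (Delta = X - X'), which is at most [e]: at a contact time in [s, t] one
   has X_i = X_(i+1) and X'_i <= X'_(i+1), hence Delta_(i+1) <= Delta_i.
   Since clamp <= 1, the flux through the left end is at most that of [L]. *)
Lemma huber_energy_step (R : realType) (p q e : R) x (B X L X' L' : int -> R -> R)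
    (m : int) (M : nat) (u : R) :
  0 < q -> 0 < p -> p < q -> 0 < e -> 0 <= u ->
  solution_path p q x B X L -> solution_path p q x B X' L' ->
  exists2 d, 0 < d & forall s t, 0 <= s -> s <= t -> `|s - u| < d -> `|t - u| < d ->
    L' m s = L' m t ->
    huber_energy (p / q) X X' m M t - huber_energy (p / q) X X' m M s <=
    q * (p / q) ^+ M.+1 * (L (m - M.+1%:Z) t - L (m - M.+1%:Z) s) +
    q * e * \sum_(k < M) ((L (m - k.+1%:Z) t - L (m - k.+1%:Z) s) +
                          (L' (m - k.+1%:Z) t - L' (m - k.+1%:Z) s)).
Proof.
move=> q0 p0 pq e0 u0 sol sol'.
have [[cX cL] _ _ con] := sol; have [[cX' cL'] _ _ con'] := sol'.
pose D k t := X (m - k%:Z) t - X' (m - k%:Z) t.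
have cD k : nonneg_continuous (D k).
  apply: within_nonneg_continuous => z.
  by apply: continuousB; [exact: cX|exact: cX'].
(* Within e / 4 of its value at [u], each D_k moves by at most e / 2 inside [s, t]; two neighbouring
   ones account for the [e] of the estimate. *)
have e2 : 0 < e / 4 by lra.
have [d d0 Hd] := @finite_radius R (fun k d => forall v, 0 <= v -> `|v - u| < d ->
    `|D k v - D k u| < e / 4) M.+1
  (fun k => let: ex_intro2 d d0 H := cD k u (e / 4) u0 e2 in
     ex_intro2 _ _ d d0 (fun d' dd' v v0 vd => H v v0 (lt_le_trans vd dd'))).
exists d => // s t s0 st sd td eL'.
have t0 : 0 <= t := le_trans s0 st.
pose l k := L (m - k%:Z) t - L (m - k%:Z) s.
pose l' k := L' (m - k%:Z) t - L' (m - k%:Z) s.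
have l0 k : 0 <= l k by rewrite subr_ge0; have [-> ] := con (m - k%:Z).
have l'0 k : 0 <= l' k by rewrite subr_ge0; have [-> ] := con' (m - k%:Z).
pose psi k := clamp (D k t).
have r0 : 0 <= p / q by rewrite divr_ge0// ltW.
have r1 : p / q <= 1 by rewrite ler_pdivrMr// mul1r ltW.
have cl c : s <= c <= t -> `|c - u| < d.
  move=> /andP[sc ct]; move: sd td; rewrite !ltr_norml => /andP[? ?] /andP[? ?].
  by apply/andP; split; lra.
have near k c : (k < M.+1)%N -> s <= c <= t -> `|D k t - D k c| <= e / 2.
  move=> kM sct; have c0 : 0 <= c by case/andP: sct => /(le_trans s0).
  have := Hd k kM c c0 (cl c sct); have := Hd k kM t t0 td.
  rewrite !ltr_norml ler_norml => /andP[? ?] /andP[? ?].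
  by apply/andP; split; lra.
have H k : (k < M)%N ->
    (psi k - psi k.+1) * (l k.+1 - l' k.+1) <= e * (l k.+1 + l' k.+1).
  move=> kM.
  have H1 : (psi k - psi k.+1) * l k.+1 <= e * l k.+1.
    have [->|lk] := eqVneq (l k.+1) 0; first by rewrite !mulr0.
    rewrite ler_wpM2r//.
    have [|c sct Xc] := path_contact (i := m - k.+1%:Z) sol s0 st.
      by move: lk; rewrite subr_eq0 eq_sym.
    have c0 : 0 <= c by case/andP: sct => /(le_trans s0).
    have := near k c (leqW kM) sct; have := near k.+1 c kM sct.
    have ord' : X' (m - k.+1%:Z) c <= X' (m - k.+1%:Z + 1) c by case: sol' => _ _ -> //.
    move: Xc ord'; rewrite subSzDr1 !ler_norml /D => Xc ord' /andP[? ?] /andP[? ?].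
    suff : clamp (D k t) <= clamp (D k.+1 t) + e by rewrite /psi; lra.
    by apply: clamp_lip; [exact: ltW|rewrite /D; lra].
  have H2 : - (psi k - psi k.+1) * l' k.+1 <= e * l' k.+1.
    have [->|lk] := eqVneq (l' k.+1) 0; first by rewrite !mulr0.
    rewrite ler_wpM2r//.
    have [|c sct Xc] := path_contact (i := m - k.+1%:Z) sol' s0 st.
      by move: lk; rewrite subr_eq0 eq_sym.
    have c0 : 0 <= c by case/andP: sct => /(le_trans s0).
    have := near k c (leqW kM) sct; have := near k.+1 c kM sct.
    have ord' : X (m - k.+1%:Z) c <= X (m - k.+1%:Z + 1) c by case: sol => _ _ -> //.
    move: Xc ord'; rewrite subSzDr1 !ler_norml /D => Xc ord' /andP[? ?] /andP[? ?].
    suff : clamp (D k.+1 t) <= clamp (D k t) + e by rewrite /psi; lra.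
    by apply: clamp_lip; [exact: ltW|rewrite /D; lra].
  by lra.
have H0 k : 0 <= e * (l k.+1 + l' k.+1).
  by apply: mulr_ge0; [exact: ltW|exact: addr_ge0].
have flux := weighted_flux_le (ltW q0) r0 r1 H H0.
have pq' : q * (p / q) = p by rewrite mulrC divfK// gt_eqF.
rewrite /huber_energy -sumrB.
apply: le_trans (le_trans _ flux) _.
  apply: ler_sum => k _; rewrite -mulrBr ler_wpM2l ?exprn_ge0//.
  apply: le_trans (huber_le _ _) _.
  rewrite /psi /D ler_wpM2l//; first by case/andP: (clamp_bounds (D k t)).
  rewrite (solution_path_increment sol sol')// pq' /l /l'.
  by rewrite subzBr1.
(* At the right end, growth of L_m only lowers the energy; growth of L'_m could raise it and is
   excluded by hypothesis. *)
have l'00 : l' 0%N = 0 by rewrite /l' subr0 eL' subrr.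
have /andP[ps0 _] := clamp_bounds (D 0%N t).
have /andP[psM0 psM1] := clamp_bounds (D M t).
rewrite lerD2r l'00 subr0.
have : 0 <= q * psi 0%N * l 0%N by rewrite !mulr_ge0// ltW.
have : q * (p / q) ^+ M.+1 * (psi M * (l M.+1 - l' M.+1)) <=
       q * (p / q) ^+ M.+1 * l M.+1.
  rewrite ler_wpM2l//; first by rewrite mulr_ge0 ?exprn_ge0// ltW.
  by have := l0 M.+1; have := l'0 M.+1; rewrite /psi; nra.
by rewrite -/(l M.+1); lra.
Qed.

(** The local error is [e] times an increase of local times. Such errors add up over [a, b] to [e]
    times the total increase [S b - S a], and [e] is arbitrary. *)
Lemma huber_energy_contraction (R : realType) (p q : R) x
    (B X L X' L' : int -> R -> R) (m : int) (M : nat) (a b : R) :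
  0 < q -> 0 < p -> p < q ->
  solution_path p q x B X L -> solution_path p q x B X' L' ->
  0 <= a -> a <= b -> L' m a = L' m b ->
  huber_energy (p / q) X X' m M b <= huber_energy (p / q) X X' m M a +
    q * (p / q) ^+ M.+1 * (L (m - M.+1%:Z) b - L (m - M.+1%:Z) a).
Proof.
move=> q0 p0 pq sol sol' a0 ab eL'.
have [_ _ _ con] := sol; have [_ _ _ con'] := sol'.
have L'c t : a <= t -> t <= b -> L' m t = L' m b.
  move=> at_ tb; have [mon _ _] := con' m; apply/eqP; rewrite eq_le.
  by rewrite mon ?(le_trans a0)//= -eL' mon.
pose S t := \sum_(k < M) (L (m - k.+1%:Z) t + L' (m - k.+1%:Z) t).
suff H e : 0 < e -> huber_energy (p / q) X X' m M b <= huber_energy (p / q) X X' m M a +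
    q * (p / q) ^+ M.+1 * (L (m - M.+1%:Z) b - L (m - M.+1%:Z) a) +
    e * (q * (S b - S a)).
  have S0 : 0 <= q * (S b - S a).
    rewrite mulr_ge0 ?(ltW q0)// -sumrB sumr_ge0// => k _.
    have [mon _ _] := con (m - k.+1%:Z); have [mon' _ _] := con' (m - k.+1%:Z).
    by rewrite opprD addrACA addr_ge0// subr_ge0; [exact: mon|exact: mon'].
  apply/ler_addgt0Pr => e e0.
  have e1 : 0 < e / (q * (S b - S a) + 1) by rewrite divr_gt0// ltr_wpDl.
  apply: le_trans (H _ e1) _; rewrite lerD2l mulrAC ler_pdivrMr ?ltr_wpDl//.
  by rewrite ler_wpM2l ?(ltW e0)// lerDl.
move=> e0.
pose H t := huber_energy (p / q) X X' m M t
  - q * (p / q) ^+ M.+1 * L (m - M.+1%:Z) t - e * (q * S t).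
suff : H b <= H a by rewrite /H; lra.
apply: local_nonincreasing => // u /andP[au ub].
have [d d0 Hd] := huber_energy_step m M q0 p0 pq e0 (le_trans a0 au) sol sol'.
exists d => // s t as_ st tb sd td.
have := Hd s t (le_trans a0 as_) st sd td.
rewrite !L'c//; try exact: le_trans st; try exact: le_trans tb.
move=> /(_ erefl).
have -> : \sum_(k < M) ((L (m - k.+1%:Z) t - L (m - k.+1%:Z) s) +
                          (L' (m - k.+1%:Z) t - L' (m - k.+1%:Z) s)) = S t - S s.
  by rewrite -sumrB; apply: eq_bigr => k _; ring.
by rewrite /H; lra.
Qed.

(** * Tracing a discrepancy to the right *)

(** (LT) for a single trajectory, at all horizons simultaneously, with r = p / q. *)
Definition vanishing_left_flux (R : realType) (r : R) (L : int -> R -> R) :=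
  forall T e : R, 0 <= T -> 0 < e ->
    exists M0 : nat, forall M, (M0 <= M)%N -> r ^+ M * L (- M%:Z) T < e.

Lemma opp_shift_index (m : int) (M0 M : nat) : (M0 + `|m| <= M)%N ->
  [/\ m - M%:Z = - (`|M%:Z - m|%N)%:Z, (M0 <= `|M%:Z - m|)%N &
      (`|M%:Z - m| <= M + `|m|)%N].
Proof. by move=> H; split; lia. Qed.

Lemma vanishing_left_flux_shift (R : realType) (r : R) (L : int -> R -> R) :
  0 < r -> r < 1 -> (forall i t, 0 <= t -> 0 <= L i t) ->
  vanishing_left_flux r L -> forall (m : int) (T e : R), 0 <= T -> 0 < e ->
    exists M0 : nat, forall M, (M0 <= M)%N -> r ^+ M * L (m - M%:Z) T < e.
Proof.
move=> r0 r1 L0 V m T e T0 e0.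
(* Moving the origin to [m] changes the weight by a factor of at most r^(-|m|). *)
have re0 : 0 < r ^+ `|m| * e by rewrite mulr_gt0 ?exprn_gt0.
have [M0 HM] := V T _ T0 re0.
exists (M0 + `|m|)%N => M MM.
have [e1 M0n Mn] := opp_shift_index MM.
have := HM _ M0n; rewrite -e1.
have L0' : 0 <= L (m - M%:Z) T by exact: L0.
have : r ^+ (M + `|m|) <= r ^+ `|M%:Z - m|.
  by apply: ler_wiXn2l; rewrite ?(ltW r0) ?(ltW r1).
rewrite exprD.
move: (L _ _) L0' (r ^+ M) (r ^+ `|m|) (r ^+ `|M%:Z - m|) re0 (exprn_gt0 `|m| r0).
move=> l l0 c c1 c2 h h' h1 h2.
have : c1 * (c * l) < c1 * e.
  by apply: le_lt_trans h2; rewrite mulrA [c1 * c]mulrC ler_wpM2r.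
by rewrite ltr_pM2l.
Qed.

Lemma local_time_ge0 (R : realType) (p q : R) x (B X L : int -> R -> R) :
  solution_path p q x B X L -> forall i t, 0 <= t -> 0 <= L i t.
Proof.
by move=> [_ _ _ con] i t t0; have [mon L0 _] := con i; rewrite -L0 mon.
Qed.

Lemma subz_absz (m i : int) : i <= m -> i = m - (`|m - i|%N)%:Z.
Proof. lia. Qed.

Lemma lez_subr_nat (m : int) (j : nat) : m - j%:Z <= m.
Proof. lia. Qed.

(** The energy is zero at time [a], so at time [b] it is at most the flux of [L] through the left
    end, which tends to 0 as M grows; a discrepancy at [i] would contribute the fixed amount [h > 0]
    for every large M. *)
Lemma comparison (R : realType) (p q : R) x (B X L X' L' : int -> R -> R)
    (m : int) (a b : R) :
  0 < q -> 0 < p -> p < q ->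
  solution_path p q x B X L -> solution_path p q x B X' L' ->
  vanishing_left_flux (p / q) L ->
  0 <= a -> a <= b -> L' m a = L' m b ->
  (forall i, i <= m -> X i a <= X' i a) ->
  forall i, i <= m -> X i b <= X' i b.
Proof.
move=> q0 p0 pq sol sol' V a0 ab eL' Xa i im.
have r0 : 0 < p / q by rewrite divr_gt0.
have r1 : p / q < 1 by rewrite ltr_pdivrMr// mul1r.
have b0 := le_trans a0 ab.
rewrite leNgt; apply/negP => Xi.
pose k := `|m - i|%N.
have ik : i = m - k%:Z by exact: subz_absz.
pose h := (p / q) ^+ k * huber (X i b - X' i b).
have h0 : 0 < h by rewrite mulr_gt0 ?exprn_gt0// huber_gt0// subr_gt0.
have hq : 0 < h / q by rewrite divr_gt0.
have [M0 HM] := vanishing_left_flux_shift r0 r1 (local_time_ge0 sol) V m b0 hq.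
pose M := (M0 + k)%N.
have := huber_energy_contraction M q0 p0 pq sol sol' a0 ab eL'.
have -> : huber_energy (p / q) X X' m M a = 0.
  rewrite /huber_energy big1// => j _; rewrite huber_le0 ?mulr0// subr_le0.
  exact/Xa/lez_subr_nat.
have : h <= huber_energy (p / q) X X' m M b.
  have kM : (k < M.+1)%N by rewrite /M ltnS leq_addl.
  rewrite /huber_energy (bigD1 (Ordinal kM))//= -ik lerDl sumr_ge0// => j _.
  by rewrite mulr_ge0 ?exprn_ge0 ?huber_ge0// ltW.
have MM : (M0 <= M.+1)%N by rewrite /M leqW// leq_addr.
have := HM _ MM; rewrite ltr_pdivlMr//.
have La := local_time_ge0 sol (m - M.+1%:Z) a0.
have : 0 <= q * (p / q) ^+ M.+1 * L (m - M.+1%:Z) a.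
  by rewrite !mulr_ge0 ?exprn_ge0// ltW.
clearbody h; clear; lra.
Qed.

Lemma addzS1 (n : int) (k : nat) : n + k%:Z + 1 = n + k.+1%:Z.
Proof. lia. Qed.

(* Follow [X'] back in time from [u] to the last contact of the pair (m, m + 1):
   since L'_m is then constant on [v, u], the comparison lemma shows that a
   discrepancy [X' < X] among the particles up to m is already present at [v]. *)
Lemma discrepancy_step (R : realType) (p q : R) x (B X L X' L' : int -> R -> R)
    (m : int) (u : R) :
  0 < q -> 0 < p -> p < q ->
  solution_path p q x B X L -> solution_path p q x B X' L' ->
  vanishing_left_flux (p / q) L ->
  0 <= u -> (exists2 i, i <= m & X' i u < X i u) ->
  exists2 v, 0 <= v <= u & (exists2 i, i <= m + 1 & X' i v < X i v) /\
    X' (m + 1) v <= X' m u + (B m v - B m u).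
Proof.
move=> q0 p0 pq sol sol' V u0 [i im Xi].
have [_ e _ con'] := sol'.
have back v : 0 <= v -> v <= u -> L' m v = L' m u ->
    exists2 i, i <= m & X' i v < X i v.
  move=> v0 vu eL; apply: contrapT => no.
  have : X i u <= X' i u.
    apply: (comparison q0 p0 pq sol sol' V v0 vu eL) => // j jm.
    by rewrite leNgt; apply/negP => Xj; apply: no; exists j.
  by rewrite leNgt Xi.
have L'0 : L' m 0 = 0 by have [_ ->] := con' m.
have [Lu|[v vu [Xv Lv]]] := path_last_contact sol' m u0.
  (* If L'_m has not grown, the discrepancy would already be present at time 0, where both solutions
     equal x + B(0). *)
  have [|j jm] := back 0 (lexx 0) u0; first by rewrite Lu.
  have [_ eX _ c] := sol; rewrite e// eX//.
  have -> : L (j - 1) 0 = 0 by have [_ ->] := c (j - 1).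
  have -> : L j 0 = 0 by have [_ ->] := c j.
  have -> : L' (j - 1) 0 = 0 by have [_ ->] := con' (j - 1).
  have -> : L' j 0 = 0 by have [_ ->] := con' j.
  by rewrite ltxx.
have /andP[v0 vu'] := vu.
exists v => //; split.
  have [j jm Xj] := back v v0 vu' Lv; exists j => //.
  by rewrite (le_trans jm)// lerDl.
(* On [v, u] the only push on X'_m comes from L'_(m-1) and is directed to the right. *)
rewrite Xv !e// Lv.
have [mon _ _] := con' (m - 1).
by have := mon v u v0 vu'; rewrite -(ler_pM2l p0); clear; lra.
Qed.

Lemma discrepancy_chain (R : realType) (p q : R) x (B X L X' L' : int -> R -> R)
    (n : int) (t : R) :
  0 < q -> 0 < p -> p < q ->
  solution_path p q x B X L -> solution_path p q x B X' L' ->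
  vanishing_left_flux (p / q) L ->
  0 <= t -> (exists2 i, i <= n & X' i t < X i t) ->
  exists s : nat -> R, [/\ s 0%N = t, (forall k, 0 <= s k.+1 <= s k) &
    forall k, X' (n + k%:Z) (s k) <= X' n t +
      \sum_(j < k) (B (n + j%:Z) (s j.+1) - B (n + j%:Z) (s j))].
Proof.
move=> q0 p0 pq sol sol' V t0 Xt.
pose P (k : nat) (u : R) := 0 <= u /\ exists2 i, i <= n + k%:Z & X' i u < X i u.
have next (w : nat * R) : P w.1 w.2 -> {v : R | P w.1.+1 v /\ v <= w.2 /\
    X' (n + w.1.+1%:Z) v <= X' (n + w.1%:Z) w.2
      + (B (n + w.1%:Z) v - B (n + w.1%:Z) w.2)}.
  move=> [w0 Hw]; apply: cid.
  have [v /andP[v0 vu] [Hv Xv]] := discrepancy_step q0 p0 pq sol sol' V w0 Hw.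
  by exists v; rewrite /P -addzS1.
have P0 : P 0%N t by split => //; rewrite addr0.
(* Besides the time, the recursion carries a discrepancy among the particles up to n + k, which is
   what [discrepancy_step] needs in order to continue. *)
pose fix s k : {u : R | P k u} :=
  if k is k'.+1 then
    exist (P k'.+1) (sval (next (k', sval (s k')) (svalP (s k'))))
      (proj1 (svalP (next (k', sval (s k')) (svalP (s k')))))
  else exist _ t P0.
have sS k := svalP (next (k, sval (s k)) (svalP (s k))).
exists (fun k => sval (s k)); split => //.
  by move=> k; have [[v0 _] [vu _]] := sS k; apply/andP.
elim=> [|k IH]; first by rewrite big_ord0 !addr0.
have [_ [_ Xv]] := sS k.
rewrite big_ord_recr/= addrA; apply: le_trans Xv _.
by rewrite lerD2r.
Qed.

(** * Exponential averages and descending paths *)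

(** Weights (1 - r) r^(k - i) on [f i] for 0 < i <= k, and the remaining mass r^k on [f 0]. *)
Fixpoint expavg (R : realType) (r : R) (f : nat -> R) (k : nat) : R :=
  if k is k'.+1 then r * expavg r f k' + (1 - r) * f k else f 0%N.

Lemma expavgB (R : realType) (r : R) (f g : nat -> R) k :
  expavg r (fun i => f i - g i) k = expavg r f k - expavg r g k.
Proof. by elim: k => //= k ->; ring. Qed.

Lemma expavg_le (R : realType) (r c : R) (f : nat -> R) k : 0 <= r <= 1 ->
  (forall i, (i <= k)%N -> f i <= c) -> expavg r f k <= c.
Proof.
move=> /andP[r0 r1]; elim: k => [|k IH] H /=; first exact: H.
have {}IH := IH (fun i ik => H i (leqW ik)).
have := ler_wpM2l r0 IH.
have r1' : 0 <= 1 - r by rewrite subr_ge0.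
have := ler_wpM2l r1' (H k.+1 (leqnn _)).
clear; lra.
Qed.

Lemma expavg_le_last (R : realType) (r : R) (f : nat -> R) k : 0 <= r <= 1 ->
  (forall i, f i <= f i.+1) -> expavg r f k <= f k.
Proof.
move=> r01 H; apply: expavg_le => // i ik.
exact: (homo_leq lexx (fun y x z => @le_trans _ _ y x z) H ik).
Qed.

Lemma expavg_nondecreasing (R : realType) (r : R) (f : nat -> R) : 0 <= r <= 1 ->
  (forall i, f i <= f i.+1) -> forall j k, (j <= k)%N -> expavg r f j <= expavg r f k.
Proof.
move=> r01 H j k jk.
apply: (homo_leq lexx (fun y x z => @le_trans _ _ y x z) _ jk) => {j k jk} k /=.
have := expavg_le_last k r01 H; have := H k; case/andP: r01 => r0 r1.
have r1' : 0 <= 1 - r by rewrite subr_ge0.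
move=> h1 h2; have := ler_wpM2l r1' (le_trans h2 h1).
clear; lra.
Qed.

(* With r = p / q the local times of the pairs (n + i, n + i + 1), 0 < i < k,
   cancel, and that of (n + k, n + k + 1) enters with a negative sign. *)
Lemma solution_expavg (R : realType) (p q : R) x (B X L : int -> R -> R) (n : int)
    (t : R) (k : nat) :
  q != 0 -> solution_path p q x B X L -> 0 <= t ->
  expavg (p / q) (fun i => X (n + i%:Z) t) k =
  expavg (p / q) (fun i => x (n + i%:Z) + B (n + i%:Z) t) k
  - (1 - p / q) * q * L (n + k%:Z) t + (p / q) ^+ k * p * (L (n - 1) t - L n t).
Proof.
move=> q0 [_ e _ _] t0; set r := p / q; have pE : p = r * q by rewrite divfK.
elim: k => [|k IH].
  by rewrite /= expr0 addr0 e// pE; ring.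
rewrite /= IH e// exprS -addzS1 addrK pE.
by move: (expavg _ _ _) => ?; ring.
Qed.

Lemma expavg_increment_le (R : realType) (p q : R) x (B X L : int -> R -> R)
    (n : int) (k : nat) (s t : R) :
  0 < q -> 0 < p -> p < q -> solution_path p q x B X L -> 0 <= s -> s <= t ->
  expavg (p / q) (fun i => X (n + i%:Z) t) k - expavg (p / q) (fun i => X (n + i%:Z) s) k <=
  expavg (p / q) (fun i => B (n + i%:Z) t) k - expavg (p / q) (fun i => B (n + i%:Z) s) k
  + p * (L (n - 1) t - L (n - 1) s).
Proof.
move=> q0 p0 pq sol s0 st; set r := p / q; have q0' : q != 0 by rewrite gt_eqF.
rewrite !(solution_expavg n k q0' sol) ?(le_trans s0)//; rewrite -/r.
have -> : expavg r (fun i => x (n + i%:Z) + B (n + i%:Z) t) k =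
    expavg r (fun i => x (n + i%:Z) + B (n + i%:Z) s) k +
    (expavg r (fun i => B (n + i%:Z) t) k - expavg r (fun i => B (n + i%:Z) s) k).
  rewrite -expavgB; apply/eqP; rewrite addrC -subr_eq -expavgB; apply/eqP.
  by congr expavg; apply/funext => i; ring.
have [_ _ _ con] := sol.
have mon i : 0 <= L i t - L i s by rewrite subr_ge0; have [->] := con i.
have r0 : 0 <= r by rewrite divr_ge0// ltW.
have r1 : r <= 1 by rewrite ler_pdivrMr// mul1r ltW.
have h1 : 0 <= (1 - r) * q * (L (n + k%:Z) t - L (n + k%:Z) s).
  by rewrite !mulr_ge0 ?mon ?subr_ge0 ?r1 ?(ltW q0).
have h2 : 0 <= r ^+ k * p * (L n t - L n s).
  by rewrite !mulr_ge0 ?mon ?exprn_ge0 ?(ltW p0).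
have h3 : r ^+ k * (p * (L (n - 1) t - L (n - 1) s)) <= p * (L (n - 1) t - L (n - 1) s).
  by rewrite ler_piMl ?exprn_ile1// mulr_ge0 ?mon ?(ltW p0).
move: h1 h2 h3; move: (expavg _ _ _) (expavg _ _ _) (expavg _ _ _).
by clear; move=> *; lra.
Qed.

(** Within a block the average of fixed length moves by noise and flux; at the end of a block it is
    shortened at a fixed time, which can only lower it since positions are ordered. The flux of
    L_(n-1) telescopes. *)
Lemma descending_path_le (R : realType) (p q : R) x (B X L : int -> R -> R)
    (n : int) (tau : nat -> R) (m : nat -> nat) (N : nat) :
  0 < q -> 0 < p -> p < q -> solution_path p q x B X L ->
  0 <= tau 0%N -> (forall j, tau j <= tau j.+1) ->
  (forall j, (j < N)%N -> (m j.+1 <= m j)%N) ->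
  expavg (p / q) (fun i => X (n + i%:Z) (tau N)) (m N) <=
  expavg (p / q) (fun i => X (n + i%:Z) (tau 0%N)) (m 0%N) +
  \sum_(j < N) (expavg (p / q) (fun i => B (n + i%:Z) (tau j.+1)) (m j)
                - expavg (p / q) (fun i => B (n + i%:Z) (tau j)) (m j)) +
  p * (L (n - 1) (tau N) - L (n - 1) (tau 0%N)).
Proof.
move=> q0 p0 pq sol tau0 taul; set r := p / q; elim: N => [|N IH] mm.
  by rewrite big_ord0 subrr mulr0 !addr0.
have {}IH := IH (fun j jN => mm j (leqW jN)).
have r0 : 0 <= r by rewrite divr_ge0// ltW.
have r1 : r <= 1 by rewrite ler_pdivrMr// mul1r ltW.
have tN j : 0 <= tau j by elim: j => // j /le_trans; apply.
have [_ _ ord _] := sol.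
have h1 : expavg r (fun i => X (n + i%:Z) (tau N.+1)) (m N.+1) <=
          expavg r (fun i => X (n + i%:Z) (tau N.+1)) (m N).
  apply: expavg_nondecreasing; rewrite ?r0 ?r1//; last exact: mm.
  by move=> i; rewrite -addzS1 ord.
have h2 := expavg_increment_le n (m N) q0 p0 pq sol (tN N) (taul N).
rewrite big_ord_recr/=.
move: h1 h2 IH; rewrite -/r; clear; lra.
Qed.

(** Uniform over real time sequences [s], since the one supplied by [discrepancy_chain] depends on
    the solutions in an uncontrolled way. *)
Definition path_noise_bounded (R : realType) (B : nat -> R -> R) (T C : R) (N : nat) :=
  forall s : nat -> R, (forall k, 0 <= s k.+1 <= s k) -> s 0%N <= T ->
    `|\sum_(k < N) (B k (s k.+1) - B k (s k))| <= C * Num.sqrt N%:R.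

(** Existence is enough: [descending_path_le] holds along every descending path, so [m] may be
    chosen with full knowledge of [B]. *)
Definition descending_gain (R : realType) (r : R) (B : nat -> R -> R)
    (T h K : R) (N : nat) :=
  exists m : nat -> nat, [/\ (forall j, (j < N)%N -> (m j.+1 <= m j)%N),
    (m 0%N < N.*2)%N &
    \sum_(j < N) (expavg r (B^~ (T + j.+1%:R * h)) (m j)
                  - expavg r (B^~ (T + j%:R * h)) (m j)) <= - K * Num.sqrt N%:R].

(** A path waiting at T up to index i and at u afterwards has a single nonzero increment, that of
    B_i. *)
Lemma path_noise_increment (R : realType) (B : nat -> R -> R) (T C u : R) (N i : nat) :
  path_noise_bounded B T C N -> 0 <= u -> u <= T -> (i < N)%N ->
  `|B i T - B i u| <= C * Num.sqrt N%:R.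
Proof.
move=> H u0 uT iN.
have := H (fun k => if (k <= i)%N then T else u).
have -> : \sum_(k < N) (B k (if (k.+1 <= i)%N then T else u) -
    B k (if (k <= i)%N then T else u)) = B i u - B i T.
  rewrite (bigD1 (Ordinal iN))//= ltnn leqnn big1 ?addr0// => k.
  rewrite -val_eqE/= => ki; case: leqP => h.
    by rewrite leqNgt ltn_neqAle [_ == _]eq_sym ki h subrr.
  by rewrite ltnW// subrr.
rewrite distrC; apply => // k.
by case: (leqP k.+1 i) => h; [rewrite (ltnW h)|case: ifP => _];
  rewrite ?lexx ?u0 ?uT// (le_trans u0).
Qed.

(** The chain of length 2 N, ending at time u, and the return from u to T each cost at most C sqrt(2
    N) <= 2 C sqrt N. A gain of (4 C + 1) sqrt N therefore leaves sqrt N <= Z with Z independent of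
    N, because N blocks of length tau / N always end at T + tau. *)
Lemma no_discrepancy (R : realType) (p q : R) x (B X L X' L' : int -> R -> R)
    (n : int) (T C : R) :
  0 < q -> 0 < p -> p < q -> 0 <= C ->
  solution_path p q x B X L -> solution_path p q x B X' L' ->
  vanishing_left_flux (p / q) L ->
  (exists N0, forall N, (N0 <= N)%N ->
     path_noise_bounded (fun k => B (n + k%:Z)) T C N) ->
  (exists2 tau, 0 < tau & exists N0, forall N, (N0 <= N)%N ->
     descending_gain (p / q) (fun k => B (n + k%:Z)) T (tau / N%:R) (4 * C + 1) N) ->
  forall t, 0 <= t <= T -> X n t <= X' n t.
Proof.
move=> q0 p0 pq c0 sol sol' V [N0 HV] [tau tau0 [N1 HG]] t /andP[t0 tT].
rewrite leNgt; apply/negP => Xt.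
have r0 : 0 <= p / q by rewrite divr_ge0// ltW.
have r1 : p / q <= 1 by rewrite ler_pdivrMr// mul1r ltW.
have r01 : 0 <= p / q <= 1 by rewrite r0.
have [s [s0 sS sX]] := discrepancy_chain q0 p0 pq sol sol' V t0 (ex_intro2 _ _ n (lexx n) Xt).
have sT k : 0 <= s k <= T.
  elim: k => [|k /andP[_ skT]]; first by rewrite s0 t0.
  by have /andP[-> /le_trans] := sS k; apply.
have T0 : 0 <= T := le_trans t0 tT.
pose Z := X' n t - X' n (T + tau) + p * L' (n - 1) (T + tau).
pose N := (N0 + N1 + (Num.truncn (Z ^+ 2)).+1)%N.
have N_gt0 : (0 < N)%N by rewrite /N addnS.
have HV2 := HV N.*2 ltac:(by rewrite -addnn /N -!addnA leq_addr).
have [m [mm m0 Hm]] := HG N ltac:(by rewrite /N addnAC leq_addl).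
have ord' (u : R) : 0 <= u -> forall i : nat, X' (n + i%:Z) u <= X' (n + i.+1%:Z) u.
  by move=> u0 i; have [_ _ o _] := sol'; rewrite -addzS1 o.
pose u := s N.*2; have /andP[u0 uT] := sT N.*2; rewrite -/u in u0 uT.
pose E t k := expavg (p / q) (fun i => X' (n + i%:Z) t) k.
(* The average stops one site below n + 2 N because the noise bound, used again on [u, T], covers
   the 2 N motions below that site only. *)
have h1 : E u N.*2.-1 <= X' n t + C * Num.sqrt N.*2%:R.
  apply: le_trans (expavg_le_last _ r01 (ord' u u0)) _.
  apply: le_trans (ord' u u0 _) _.
  rewrite prednK ?double_gt0//; apply: le_trans (sX _) _.
  rewrite lerD2l; apply: le_trans (ler_norm _) _.
  by apply: (HV2 s sS _); rewrite s0.
have h2 : E T N.*2.-1 <= E u N.*2.-1 + C * Num.sqrt N.*2%:R + p * (L' (n - 1) T - L' (n - 1) u).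
  have := expavg_increment_le n N.*2.-1 q0 p0 pq sol' u0 uT.
  rewrite -[X in _ <= X + _]expavgB.
  have : expavg (p / q) (fun i => B (n + i%:Z) T - B (n + i%:Z) u) N.*2.-1 <= C * Num.sqrt N.*2%:R.
    apply: expavg_le => // i iN; apply: le_trans (ler_norm _) _.
    apply: (@path_noise_increment _ (fun k => B (n + k%:Z)) T C u N.*2 i HV2 u0 uT _).
    by rewrite -[X in (_ < X)%N]prednK ?double_gt0.
  rewrite /E; clear; lra.
have h3 : E T (m 0%N) <= E T N.*2.-1.
  apply: expavg_nondecreasing => //; first exact: ord'.
  by rewrite -ltnS prednK ?double_gt0.
pose tm j := T + j%:R * (tau / N%:R).
have tm0 : tm 0%N = T by rewrite /tm mul0r addr0.
have tmN : tm N = T + tau by rewrite /tm mulrC divfK// pnatr_eq0 -lt0n.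
have h4 : E (tm N) (m N) <= E T (m 0%N) - (4 * C + 1) * Num.sqrt N%:R
    + p * (L' (n - 1) (tm N) - L' (n - 1) T).
  have := @descending_path_le _ p q x B X' L' n tm m N q0 p0 pq sol'.
  rewrite tm0 => /(_ T0) H; apply: le_trans (H _ _) _ => //.
    move=> j; rewrite /tm lerD2l ler_wpM2r ?divr_ge0 ?(ltW tau0)//.
    by rewrite ler_nat.
  by rewrite lerD2r lerD2l; rewrite -mulNr.
have h5 : X' n (T + tau) <= E (tm N) (m N).
  rewrite tmN; have -> : X' n (T + tau) = E (T + tau) 0%N by rewrite /E /= addr0.
  apply: expavg_nondecreasing => //.
  by apply: ord'; rewrite addr_ge0// ltW.
have Lu := local_time_ge0 sol' (n - 1) u0.
have pLu : 0 <= p * L' (n - 1) u by rewrite mulr_ge0// ltW.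
have sq2 : Num.sqrt N.*2%:R <= 2 * Num.sqrt N%:R :> R.
  rewrite -ler_sqr ?nnegrE ?mulr_ge0 ?sqrtr_ge0// exprMn !sqr_sqrtr//.
  by rewrite -mul2n natrM ler_wpM2r// expr2; lra.
have csq := ler_wpM2l c0 sq2.
have : Num.sqrt N%:R <= Z.
  rewrite tmN in h4 h5.
  move: h1 h2 h3 h4 h5 pLu csq; rewrite /Z; clear; lra.
rewrite leNgt => /negP; apply; apply: le_lt_trans (ler_norm _) _.
rewrite -sqrtr_sqr ltr_sqrt ?ltr0n//.
apply: lt_le_trans (truncnS_gt _) _.
by rewrite ler_nat /N leq_addl.
Qed.

(** * Independence and Gaussian increments *)

Lemma integral_simple_sum (d : measure_display) (T : measurableType d) (R : realType)
    (mu : {measure set T -> \bar R}) (Y V : T -> R) (g : {nnsfun R >-> R}) :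
  measurable_fun setT Y -> measurable_fun setT V -> (forall w, 0 <= V w) ->
  (\int[mu]_w (g (Y w) * V w)%:E =
   \sum_(y <- finmap.enum_fset (fset_set (range g)))
     y%:E * \int[mu]_w (\1_(g @^-1` [set y]) (Y w) * V w)%:E)%E.
Proof.
move=> mY mV V0.
have mpre (y : R) : measurable (g @^-1` [set y]) by exact: measurable_sfunP.
have m1 (y : R) : measurable_fun setT (fun w => \1_(g @^-1` [set y]) (Y w) : R).
  by apply: measurableT_comp => //; exact: measurable_indic.
have decomp w : g (Y w) = \sum_(y <- finmap.enum_fset (fset_set (range g)))
    y * \1_(g @^-1` [set y]) (Y w).
  by rewrite fimfunE fsbig_finite.
have y0 (y : R) w : 0 <= y * \1_(g @^-1` [set y]) (Y w).
  by rewrite -lee_fin EFinM; exact: nnfun_muleindic_ge0.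
transitivity (\sum_(y <- finmap.enum_fset (fset_set (range g)))
    \int[mu]_w (y * \1_(g @^-1` [set y]) (Y w) * V w)%:E)%E.
  rewrite -ge0_integral_sum//.
  - by apply: eq_integral => w _; rewrite decomp mulr_suml sumEFin.
  - move=> y; apply/measurable_EFinP; apply: measurable_funM => //.
    exact: measurable_funM.
  - by move=> y w _; rewrite lee_fin mulr_ge0.
apply: eq_bigr => y _; have [yp|yn] := leP 0 y.
  under eq_integral do rewrite -mulrA EFinM.
  rewrite ge0_integralZl//.
  - by apply/measurable_EFinP; exact: measurable_funM.
  - by move=> w _; rewrite lee_fin mulr_ge0// indicE.
have pre0 : g @^-1` [set y] = set0.
  rewrite -subset0 => z /= gz; have : 0 <= g z by exact: fun_ge0.
  by rewrite gz leNgt yn.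
rewrite pre0.
under eq_integral do rewrite indic0 mulr0 mul0r.
under [in RHS]eq_integral do rewrite indic0 mul0r.
by rewrite integral0 mule0.
Qed.

(** Extension from indicators to nonnegative functions by simple functions and monotone convergence.
    Two measures, a weight and a constant are allowed so that it yields both factorisation under
    independence and integration against a density. *)
Lemma integral_weight (d d' : measure_display) (T : measurableType d)
    (T' : measurableType d') (R : realType)
    (mu : {measure set T -> \bar R}) (nu : {measure set T' -> \bar R})
    (Y W : T -> R) (Y' : T' -> R) (K : R) (f : R -> R) :
  measurable_fun setT f -> (forall y, 0 <= f y) ->
  measurable_fun setT Y -> measurable_fun setT Y' ->
  measurable_fun setT W -> (forall w, 0 <= W w) -> 0 <= K ->
  (forall A : set R, measurable A ->
    (\int[mu]_w (\1_A (Y w) * W w)%:E = nu (Y' @^-1` A) * K%:E)%E) ->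
  (\int[mu]_w (f (Y w) * W w)%:E = (\int[nu]_w (f (Y' w))%:E) * K%:E)%E.
Proof.
move=> mf f0 mY mY' mW W0 K0 H.
have mfE : measurable_fun setT (EFin \o f) by exact/measurable_EFinP.
pose g := nnsfun_approx measurableT mfE.
have gY (y : R) : (g n y)%:E @[n --> \oo] --> (f y)%:E.
  by apply: (cvg_nnsfun_approx measurableT mfE) => // z _; rewrite lee_fin.
have ndg (y : R) : {homo (fun n => g n y) : m n / (m <= n)%N >-> m <= n}.
  by move=> m n mn; have /lefP := nd_nnsfun_approx measurableT mfE mn; apply.
have lim1 : (\int[nu]_w (g n (Y' w))%:E)%E @[n --> \oo] --> (\int[nu]_w (f (Y' w))%:E)%E.
  have -> : (\int[nu]_w (f (Y' w))%:E)%E = (\int[nu]_w limn (fun n => (g n (Y' w))%:E))%E.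
    by apply: eq_integral => w _; apply/esym/cvg_lim => //; exact: gY.
  apply: (cvg_monotone_convergence measurableT (g' := fun n w => (g n (Y' w))%:E)).
  - by move=> n; apply/measurable_EFinP; apply: measurableT_comp.
  - by move=> n w _; rewrite lee_fin.
  - by move=> w _ m n mn; rewrite lee_fin; exact: ndg.
have lim2 : (\int[mu]_w (g n (Y w) * W w)%:E)%E @[n --> \oo] --> (\int[mu]_w (f (Y w) * W w)%:E)%E.
  have -> : (\int[mu]_w (f (Y w) * W w)%:E)%E =
            (\int[mu]_w limn (fun n => (g n (Y w) * W w)%:E))%E.
    apply: eq_integral => w _; apply/esym/cvg_lim => //.
    rewrite EFinM; under eq_fun do rewrite EFinM.
    by apply: cvgeZr => //; exact: gY.
  apply: (cvg_monotone_convergence measurableT (g' := fun n w => (g n (Y w) * W w)%:E)).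
  - move=> n; apply/measurable_EFinP; apply: measurable_funM => //.
    exact: measurableT_comp.
  - by move=> n w _; rewrite lee_fin mulr_ge0.
  - by move=> w _ m n mn; rewrite lee_fin ler_wpM2r//; exact: ndg.
rewrite -(cvg_lim _ lim2)//; apply/cvg_lim => //.
suff simple n : (\int[mu]_w (g n (Y w) * W w)%:E = (\int[nu]_w (g n (Y' w))%:E) * K%:E)%E.
  by under eq_fun do rewrite simple; exact: cvgeZr.
have -> : (\int[nu]_w (g n (Y' w))%:E = \int[nu]_w (g n (Y' w) * 1)%:E)%E.
  by apply: eq_integral => w _; rewrite mulr1.
rewrite !integral_simple_sum// muleC ge0_sume_distrr; last first.
  move=> y _; have [yp|yn] := leP 0 y.
    by apply: mule_ge0 => //; apply: integral_ge0 => w _; rewrite lee_fin mulr1.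
  have pre0 : g n @^-1` [set y] = set0.
    rewrite -subset0 => z /= gz; have : 0 <= g n z by exact: fun_ge0.
    by rewrite gz leNgt yn.
  by rewrite integral0_eq ?mule0// => w _; rewrite pre0 indic0 mul0r.
apply: eq_bigr => y _.
have mpre : measurable (g n @^-1` [set y]) by exact: measurable_sfunP.
rewrite H// muleA [LHS]muleC; congr (_ * (_ * _))%E.
under eq_integral do rewrite mulr1.
have mA : measurable (Y' @^-1` (g n @^-1` [set y])).
  by rewrite -[X in measurable X]setTI; exact: mY'.
by apply/esym; apply: etrans (integral_indic nu measurableT mA) _; rewrite setIT.
Qed.

Lemma prod_indic (T : Type) (R : realType) (I : eqType) (s : seq I)
    (A : I -> set T) (w : T) :
  \prod_(i <- s) \1_(A i) w = \1_(\bigcap_(i in [set` s]) A i) w :> R.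
Proof.
elim: s => [|i s IH]; first by rewrite big_nil set_nil bigcap_set0 indicT.
have -> : [set` i :: s] = i |` [set` s].
  by apply/seteqP; split=> j /=; rewrite in_cons;
    [move=> /predU1P[->|]; [left|right]|move=> [->|->]; rewrite ?eqxx ?orbT].
by rewrite big_cons IH bigcap_setU1 indicI.
Qed.

(** Independence is given for events. The generalised claim has functions on [s1] and indicators on
    [s2]; each step of the induction turns one indicator into a function, all other factors acting
    as the weight. *)
Lemma integral_prod_independent (d : measure_display) (T : measurableType d)
    (R : realType) (P : probability T R) (I : eqType) (G : I -> set (set T))
    (Y : I -> T -> R) (e : I -> R) :
  mutually_independent P G -> (forall i, G i `<=` measurable) ->
  (forall i, measurable_wrt (G i) (Y i)) ->
  (forall i w, 0 <= Y i w) ->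
  (forall i, (\int[P]_w (Y i w)%:E = (e i)%:E)%E) ->
  forall s : seq I, uniq s ->
    (\int[P]_w (\prod_(i <- s) Y i w)%:E = (\prod_(i <- s) e i)%:E)%E.
Proof.
move=> indep Gm YG Y0 Ye s us.
have mY i : measurable_fun setT (Y i).
  by move=> _ A mA; rewrite setTI; exact/Gm/YG.
have e0 i : 0 <= e i by rewrite -lee_fin -Ye integral_ge0// => w _; rewrite lee_fin.
suff H (s1 s2 : seq I) (A : I -> set R) : uniq (s1 ++ s2) ->
    (forall i, measurable (A i)) ->
    (\int[P]_w (\prod_(i <- s1) Y i w * \prod_(i <- s2) \1_(Y i @^-1` A i) w)%:E =
     (\prod_(i <- s1) e i * \prod_(i <- s2) fine (P (Y i @^-1` A i)))%:E)%E.
  have := H s [::] (fun=> setT); rewrite cats0 => /(_ us (fun=> measurableT)).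
  by under eq_integral do rewrite big_nil mulr1; rewrite big_nil mulr1.
elim: s1 s2 A => [|i s1 IH] s2 A /=.
  move=> us2 mA; rewrite big_nil mul1r.
  under eq_integral do rewrite big_nil mul1r prod_indic.
  have mI : measurable (\bigcap_(i in [set` s2]) (Y i @^-1` A i)).
    apply: fin_bigcap_measurable; first exact: finite_seq.
    by move=> i _; exact/Gm/YG.
  rewrite integral_indic// setIT.
  apply: etrans (indep s2 (fun i => Y i @^-1` A i) us2 _) _.
    by move=> i _; exact: YG.
  elim: s2 {us2 mI} => [|j s2 IH]; first by rewrite !big_nil.
  by rewrite !big_cons IH EFinM fineK// fin_num_measure//; exact/Gm/YG.
move=> /andP[iN us2] mA.
have mW : measurable_fun setT (fun w => \prod_(j <- s1) Y j w *
    \prod_(j <- s2) (\1_(Y j @^-1` A j) w : R)).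
  apply: measurable_funM; first by apply: measurable_prod.
  by apply: measurable_prod => j _; apply: measurable_indic; exact/Gm/YG.
have p0 (B : I -> set R) (r : seq I) : 0 <= \prod_(j <- r) fine (P (Y j @^-1` B j)).
  by apply: prodr_ge0 => j _; exact: fine_ge0.
have W0 w : 0 <= \prod_(j <- s1) Y j w * \prod_(j <- s2) (\1_(Y j @^-1` A j) w : R).
  by rewrite mulr_ge0// prodr_ge0// => j _; rewrite indicE.
have K0 : 0 <= \prod_(j <- s1) e j * \prod_(j <- s2) fine (P (Y j @^-1` A j)).
  by rewrite mulr_ge0// prodr_ge0.
rewrite big_cons; under eq_integral do rewrite big_cons -mulrA.
(* [integral_weight] asks for a function that is nonnegative on the whole line; the absolute value
   agrees with the identity on the values of [Y i]. *)
have h (w : T) : Y i w = Num.norm (Y i w) by rewrite ger0_norm.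
transitivity ((\int[P]_w (`|Y i w|)%:E) * (\prod_(j <- s1) e j *
    \prod_(j <- s2) fine (P (Y j @^-1` A j)))%:E)%E; last first.
  by under eq_integral do rewrite -h; rewrite Ye -EFinM mulrA.
under eq_integral do rewrite h.
apply: integral_weight => // B mB.
pose A' j := if j == i then B else A j.
have mA' j : measurable (A' j) by rewrite /A'; case: ifP.
have us2' : uniq (s1 ++ i :: s2).
  by rewrite -cat1s uniq_catCA cat1s /= iN.
have := IH (i :: s2) A' us2' mA'.
have As2 (j : I) : j \in s2 -> A' j = A j.
  move=> js2; rewrite /A'; case: eqP => // ji.
  by move: iN; rewrite -ji mem_cat js2 orbT.
have A'i : A' i = B by rewrite /A' eqxx.
have e1 : \prod_(j <- s2) fine (P (Y j @^-1` A' j)) =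
          \prod_(j <- s2) fine (P (Y j @^-1` A j)).
  by apply: eq_big_seq => j js2; rewrite As2.
have e2 w : \prod_(j <- s2) \1_(Y j @^-1` A' j) w =
            \prod_(j <- s2) \1_(Y j @^-1` A j) w :> R.
  by apply: eq_big_seq => j js2; rewrite As2.
rewrite big_cons A'i e1.
have pfin : P (Y i @^-1` B) \is a fin_num by apply: fin_num_measure; exact/Gm/YG.
rewrite mulrCA EFinM fineK// => <-.
apply: eq_integral => w _; congr EFin.
rewrite big_cons A'i e2.
by rewrite mulrCA.
Qed.

Lemma integral_normal (d : measure_display) (T : measurableType d) (R : realType)
    (P : probability T R) (xi : T -> R) (s : R) (f : R -> R) :
  measurable_fun setT xi ->
  (forall A : set R, measurable A -> P (xi @^-1` A) = normal_prob 0 s A) ->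
  measurable_fun setT f -> (forall y, 0 <= f y) ->
  (\int[P]_w (f (xi w))%:E = \int[lebesgue_measure]_x (f x * normal_pdf 0 s x)%:E)%E.
Proof.
move=> mxi law mf f0; apply/esym.
have := @integral_weight _ _ (measurableTypeR R) T R lebesgue_measure P id
  (normal_pdf 0 s) xi 1 f mf f0
  (@measurable_id _ _ _) mxi (@measurable_normal_pdf _ _ _) (@normal_pdf_ge0 _ _ _) ler01.
rewrite mule1; apply => A mA; rewrite mule1.
apply: (etrans _ (esym (law A mA))); rewrite /normal_prob.
rewrite [RHS]integral_mkcond; apply: eq_integral => x _.
by rewrite epatch_indic -EFinM mulrC.
Qed.

Lemma normal_pdf_peak (R : realType) (m s x : R) : s != 0 ->
  normal_pdf m s x = normal_peak s * normal_fun m s x.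
Proof. by move=> s0; rewrite normal_pdfE. Qed.

(** Completing the square: an exponential tilt moves the mean to l s^2, and the shifted density
    again has mass 1. *)
Lemma normal_pdf_tilt (R : realType) (s l x : R) : s != 0 ->
  expR (l * x) * normal_pdf 0 s x =
  expR (l ^+ 2 * s ^+ 2 / 2) * normal_pdf (l * s ^+ 2) s x.
Proof.
move=> s0; rewrite !normal_pdf_peak// /normal_fun.
rewrite mulrCA [RHS]mulrCA -!expRD; congr (_ * expR _).
by field.
Qed.

Lemma normal_mgf (d : measure_display) (T : measurableType d) (R : realType)
    (P : probability T R) (xi : T -> R) (s l : R) : s != 0 ->
  measurable_fun setT xi ->
  (forall A : set R, measurable A -> P (xi @^-1` A) = normal_prob 0 s A) ->
  (\int[P]_w (expR (l * xi w))%:E = (expR (l ^+ 2 * s ^+ 2 / 2))%:E)%E.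
Proof.
move=> s0 mxi law.
have mf : measurable_fun [set: R] (fun y => expR (l * y)).
  by apply: measurableT_comp => //; exact: measurable_funM.
rewrite (integral_normal mxi law mf) => [|y]; last exact: expR_ge0.
under eq_integral do rewrite normal_pdf_tilt// EFinM.
rewrite ge0_integralZl//.
- by rewrite integral_normal_pdf mule1.
- by apply/measurable_EFinP; exact: measurable_normal_pdf.
- by move=> x _; rewrite lee_fin normal_pdf_ge0.
Qed.

(** The length of [-2 s, -s] times the centred density of standard deviation s at -2 s; the product
    is free of s. *)
Definition normal_tail (R : realType) : R := (expR 2 * Num.sqrt (pi *+ 2))^-1.

Lemma normal_tail_gt0 (R : realType) : 0 < normal_tail R.
Proof.
by rewrite /normal_tail invr_gt0 mulr_gt0 ?expR_gt0// sqrtr_gt0 pmulrn_lgt0 ?pi_gt0.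
Qed.

Lemma normal_tail_le (R : realType) (s : R) : 0 < s ->
  ((normal_tail R)%:E <= normal_prob 0%R s `]-oo, (- s)%R]%classic)%E.
Proof.
move=> s0; rewrite /normal_prob.
have sub : `[- (2 * s), - s]%classic `<=` `]-oo, - s]%classic.
  by move=> x /=; rewrite !in_itv/= => /andP[].
apply: (@le_trans _ _
    (\int[lebesgue_measure]_(x in `[(- (2 * s))%R, (- s)%R]) (normal_pdf 0 s x)%:E)%E); last first.
  apply: ge0_subset_integral => //.
  - by apply/measurable_EFinP; apply: measurable_funTS; exact: measurable_normal_pdf.
  - by move=> x _; rewrite lee_fin normal_pdf_ge0.
apply: (@le_trans _ _ (\int[lebesgue_measure]_(x in `[(- (2 * s))%R, (- s)%R])
  (normal_tail R / s)%:E)%E).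
    rewrite integral_cst//= lebesgue_measure_itv/= lte_fin ltrN2 ltr_pMl// ltr1n.
    rewrite -EFinB -EFinM lee_fin; have -> : - s - - (2 * s) = s by ring.
    by rewrite divfK// gt_eqF.
  apply: ge0_le_integral => //.
  + by move=> x _; rewrite lee_fin divr_ge0 ?ltW// normal_tail_gt0.
  + by apply/measurable_EFinP; apply: measurable_funTS; exact: measurable_normal_pdf.
  move=> x; rewrite /= in_itv/= => /andP[x1 x2]; rewrite lee_fin.
  rewrite normal_pdf_peak ?gt_eqF// /normal_fun /normal_peak /normal_tail.
  have c0 : 0 < Num.sqrt (pi *+ 2) :> R by rewrite sqrtr_gt0 pmulrn_lgt0 ?pi_gt0.
  have -> : Num.sqrt (s ^+ 2 * pi *+ 2) = s * Num.sqrt (pi *+ 2).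
    by rewrite -mulrnAr sqrtrM ?sqr_ge0// sqrtr_sqr gtr0_norm.
  have -> : (expR 2 * Num.sqrt (pi *+ 2))^-1 / s = (s * Num.sqrt (pi *+ 2))^-1 * expR (- 2).
    by rewrite expRN -!invfM mulrC [expR 2 * _]mulrC mulrA.
  apply: ler_wpM2l; first by rewrite invr_ge0 mulr_ge0// ltW.
  rewrite subr0 ler_expR mulNr lerN2.
  have s20 : 0 < s ^+ 2 *+ 2 by rewrite pmulrn_lgt0// exprn_gt0.
  rewrite ler_pdivrMr//.
  have : 0 <= (2 * s - x) * (2 * s + x) by rewrite mulr_ge0//; lra.
  by rewrite -mulr_natr; nra.
Qed.

Definition brownian_family (d : measure_display) (Omega : measurableType d) (R : realType)
    (P : probability Omega R) (B : nat -> R -> Omega -> R) :=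
  (forall k, standard_brownian_motion P (B k)) /\
  mutually_independent P (fun k => sigma_of [set t : R | 0 <= t] (B k)).

Lemma brownian_family_shift (d : measure_display) (Omega : measurableType d) (R : realType)
    (P : probability Omega R) F (B : int -> R -> Omega -> R) (n : int) :
  independent_brownian_motions P F B -> brownian_family P (fun k => B (n + k%:Z)).
Proof.
move=> [sbm indep _ _]; split=> [k|s A us HA]; first exact: sbm.
pose h (k : nat) := n + k%:Z.
have injh : injective h by move=> i j /addrI [].
have hK (k : nat) : `|h k - n|%N = k by rewrite /h addrC addKr.
have := indep (map h s) (fun i => A `|i - n|%N).
rewrite (map_inj_uniq injh) => /(_ us).
have -> : \bigcap_(i in [set` map h s]) A `|i - n|%N = \bigcap_(i in [set` s]) A i.
  apply/seteqP; split=> w H i /= is_.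
    by have := H (h i) (map_f h is_); rewrite hK.
  by case/mapP: is_ => k ks ->; rewrite hK; exact: H.
rewrite big_map => ->.
  by apply: eq_bigr => i _; rewrite hK.
by move=> i /mapP[k ks ->]; rewrite hK; exact: HA.
Qed.

Lemma measurable_wrt_sigma_of (d : measure_display) (Omega : measurableType d) (R : realType)
    (I : Type) (D : set I) (Y : I -> Omega -> R) i : D i ->
  measurable_fun (setT : set (g_sigma_algebraType (\bigcup_(i in D)
        preimage_set_system setT (Y i) (@measurable _ (measurableTypeR R)))))
    (Y i : _ -> R).
Proof.
move=> Di _ A mA; apply: sub_sigma_algebra; exists i => //.
by exists A.
Qed.

Lemma sigma_of_measurable (d : measure_display) (Omega : measurableType d) (R : realType)
    (I : Type) (D : set I) (Y : I -> Omega -> R) :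
  (forall i, D i -> measurable_fun setT (Y i)) -> sigma_of D Y `<=` measurable.
Proof.
move=> mY; apply: smallest_sub; first exact: sigma_algebra_measurable.
by move=> A [i Di] [B mB <-]; exact: mY.
Qed.

(** Independence acts twice: among the increments of one motion over successive blocks, then among
    the motions. *)
Lemma brownian_block_product (d : measure_display) (Omega : measurableType d) (R : realType)
    (P : probability Omega R) (B : nat -> R -> Omega -> R) (tau : nat -> R)
    (f : nat -> nat -> R -> R) (e : nat -> nat -> R) (N M : nat) :
  brownian_family P B -> 0 <= tau 0%N -> (forall j, tau j <= tau j.+1) ->
  (forall k j, measurable_fun setT (f k j)) -> (forall k j y, 0 <= f k j y) ->
  (forall k j, (\int[P]_w (f k j (B k (tau j.+1) w - B k (tau j) w))%:E = (e k j)%:E)%E) ->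
  (\int[P]_w (\prod_(k < N) \prod_(j < M) f k j (B k (tau j.+1) w - B k (tau j) w))%:E =
   (\prod_(k < N) \prod_(j < M) e k j)%:E)%E.
Proof.
move=> [sbm indep] tau0 taul mf f0 fe.
have t0 j : 0 <= tau j by elim: j => // j /le_trans; apply.
pose Y k w := \prod_(j < M) f k j (B k (tau j.+1) w - B k (tau j) w).
have mB k t : 0 <= t -> measurable_fun setT (B k t) by have [+ _ _ _] := sbm k; apply.
have inner k : (\int[P]_w (Y k w)%:E = (\prod_(j < M) e k j)%:E)%E.
  have [_ _ _ /(_ tau tau0 taul) indk] := sbm k.
  have mxi j : measurable_fun setT (fun w => B k (tau j.+1) w - B k (tau j) w).
    by apply: measurable_funB; exact: mB.
  have := @integral_prod_independent _ _ _ P nat _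
    (fun j w => f k j (B k (tau j.+1) w - B k (tau j) w)) (e k) indk _ _ _ _
  (index_iota 0 M) (iota_uniq 0 _).
  rewrite big_mkord => <-.
  - by apply: eq_integral => w _; rewrite big_mkord.
  - by move=> j A [C mC <-]; exact: mxi.
  - move=> j A mA; exists (f k j @^-1` A); last by rewrite setTI.
    by rewrite -[X in measurable X]setTI; exact: mf.
  - by [].
  - by move=> j; exact: fe.
have := @integral_prod_independent _ _ _ P nat _ Y (fun k => \prod_(j < M) e k j) indep _ _ _ _
  (index_iota 0 N) (iota_uniq 0 _).
rewrite big_mkord => <-.
- by apply: eq_integral => w _; rewrite big_mkord.
- by move=> k; apply: sigma_of_measurable => t /= t0'; exact: mB.
- move=> k A mA; rewrite -[X in sigma_of _ _ X]setTI.
  pose G := \bigcup_(i in [set t : R | 0 <= t])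
        preimage_set_system setT (B k i) (@measurable _ (measurableTypeR R)).
  have mG t : 0 <= t -> measurable_fun (setT : set (g_sigma_algebraType G)) (B k t : _ -> R).
    by move=> t0'; exact: (@measurable_wrt_sigma_of _ _ _ _ [set t : R | 0 <= t] (B k) t t0').
  suff : measurable_fun (setT : set (g_sigma_algebraType G)) (Y k : _ -> R) by apply.
  apply: measurable_prod => j _; apply: measurableT_comp; first exact: mf.
  by apply: measurable_funB; exact: mG.
- by move=> k w; exact: prodr_ge0.
- exact: inner.
Qed.

Lemma brownian_increment_mgf (d : measure_display) (Omega : measurableType d) (R : realType)
    (P : probability Omega R) (B : R -> Omega -> R) (s t l : R) :
  standard_brownian_motion P B -> 0 <= s -> s <= t ->
  (\int[P]_w (expR (l * (B t w - B s w)))%:E = (expR (l ^+ 2 * (t - s) / 2))%:E)%E.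
Proof.
move=> [mB _ law _] s0; rewrite le_eqVlt => /predU1P[->|st].
  under eq_integral do rewrite subrr mulr0 expR0.
  by rewrite integral_cst// subrr mulr0 mul0r expR0 mul1e; exact: probability_setT.
have ts0 : 0 < t - s by rewrite subr_gt0.
rewrite (@normal_mgf _ _ _ P (fun w => B t w - B s w) (Num.sqrt (t - s))).
- by rewrite sqr_sqrtr// ltW.
- by rewrite gt_eqF// sqrtr_gt0.
- by apply: measurable_funB; apply: mB => //; rewrite (le_trans s0)// ltW.
- by move=> A mA; exact: law.
Qed.

(** Each motion contributes one increment, so the time intervals of different motions may overlap
    freely. *)
Lemma brownian_sum_mgf (d : measure_display) (Omega : measurableType d) (R : realType)
    (P : probability Omega R) (B : nat -> R -> Omega -> R) (s t : nat -> R) (l : R) (N : nat) :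
  brownian_family P B -> (forall k, 0 <= s k) -> (forall k, s k <= t k) ->
  (\int[P]_w (expR (l * \sum_(k < N) (B k (t k) w - B k (s k) w)))%:E =
   (expR (l ^+ 2 * (\sum_(k < N) (t k - s k)) / 2))%:E)%E.
Proof.
move=> [sbm indep] s0 st.
have mB k u : 0 <= u -> measurable_fun setT (B k u) by have [+ _ _ _] := sbm k; apply.
have t0 k : 0 <= t k by rewrite (le_trans (s0 k)).
have := @integral_prod_independent _ _ _ P nat _
  (fun k w => expR (l * (B k (t k) w - B k (s k) w)))
  (fun k => expR (l ^+ 2 * (t k - s k) / 2)) indep _ _ _ _ (index_iota 0 N) (iota_uniq 0 _).
rewrite big_mkord mulr_sumr mulr_suml expR_sum => <-.
- by apply: eq_integral => w _; rewrite big_mkord mulr_sumr expR_sum.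
- by move=> k; apply: sigma_of_measurable => u /= u0; exact: mB.
- move=> k A mA; rewrite -[X in sigma_of _ _ X]setTI.
  pose G := \bigcup_(i in [set t : R | 0 <= t])
        preimage_set_system setT (B k i) (@measurable _ (measurableTypeR R)).
  have mG u : 0 <= u -> measurable_fun (setT : set (g_sigma_algebraType G)) (B k u : _ -> R).
    by move=> u0; exact: (@measurable_wrt_sigma_of _ _ _ _ [set t : R | 0 <= t] (B k) u u0).
  suff : measurable_fun (setT : set (g_sigma_algebraType G))
    (fun w => expR (l * (B k (t k) w - B k (s k) w)) : R) by apply.
  apply: measurableT_comp => //; apply: measurable_funM => //.
  by apply: measurable_funB; exact: mG.
- by move=> k w; exact: expR_ge0.
- by move=> k; exact: brownian_increment_mgf.
Qed.

(** * Maximal noise along monotone paths *)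

Lemma nneseries_geometric_le (R : realType) (u : nat -> \bar R) (c rho : R) :
  0 <= rho -> rho < 1 ->
  (forall n, 0 <= u n)%E -> (forall n, u n <= (c * rho ^+ n)%:E)%E ->
  (\sum_(0 <= n <oo) u n <= (c / (1 - rho))%:E)%E.
Proof.
move=> rho0 rho1 u0 uc; apply: lime_le.
  by apply: is_cvg_nneseries => n _ _; exact: u0.
apply: nearW => n.
have c0 : 0 <= c.
  have := le_trans (u0 0%N) (uc 0%N); by rewrite expr0 mulr1 lee_fin.
apply: (@le_trans _ _ (\sum_(0 <= k < n) (c * rho ^+ k))%:E).
  by rewrite -sumEFin; apply: lee_sum => k _; exact: uc.
have r1 : 1 - rho != 0 by rewrite subr_eq0 gt_eqF.
rewrite lee_fin -mulr_sumr ler_wpM2l//.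
suff -> : \sum_(0 <= k < n) rho ^+ k = (1 - rho)^-1 - rho ^+ n / (1 - rho).
  by rewrite gerBl divr_ge0 ?exprn_ge0// subr_ge0 ltW.
elim: n => [|n IH]; first by rewrite big_nil expr0; field.
by rewrite big_nat_recr//= IH exprS; move: (rho ^+ n) => y; field.
Qed.

(** The series has finite expectation, so almost surely its tails, which dominate its terms, tend to
    0. In the applications [Y n] is an exponential majorant, and [Y n < 1] is the bound sought. *)
Lemma summable_expectation_ae (d : measure_display) (T : measurableType d) (R : realType)
    (P : {measure set T -> \bar R}) (Y : nat -> T -> \bar R) (c rho : R) :
  0 <= rho -> rho < 1 ->
  (forall n, measurable_fun setT (Y n)) -> (forall n w, 0 <= Y n w)%E ->
  (forall n, \int[P]_w Y n w <= (c * rho ^+ n)%:E)%E ->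
  \forall w \ae P, exists n0, forall n, (n0 <= n)%N -> (Y n w < 1)%E.
Proof.
move=> rho0 rho1 mY Y0 EY.
pose f w := (\sum_(0 <= n <oo) Y n w)%E.
have mf : measurable_fun setT f by apply: ge0_emeasurable_sum.
have f0 w : (0 <= f w)%E by apply: nneseries_ge0 => n _ _.
have intf : P.-integrable setT f.
  apply/integrableP; split => //.
  under eq_integral do rewrite gee0_abs//.
  rewrite integral_nneseries//; apply: le_lt_trans (ltry (c / (1 - rho))).
  by apply: nneseries_geometric_le => // n; apply: integral_ge0.
apply: filterS (integrable_ae measurableT intf) => w /(_ I) fw.
have fwoo : (f w < +oo)%E by rewrite ltey_eq fw.
have /fine_cvgP[_ /cvgrPdist_lt /(_ 1 ltr01)] := nneseries_tail_cvg fwoo (fun n _ => Y0 n w).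
have tailfin n : (\sum_(n <= k <oo) Y k w)%E \is a fin_num.
  rewrite ge0_fin_numE; last by apply: nneseries_ge0 => k _ _.
  apply: le_lt_trans fwoo; rewrite /f (nneseries_split 0 n)//.
  by rewrite add0n leeDr// sume_ge0.
move=> [n0 _ H]; exists n0 => n n0n.
have := H n n0n; rewrite /= sub0r normrN ger0_norm; last first.
  by apply: fine_ge0; apply: nneseries_ge0 => k _ _.
rewrite -lte_fin fineK//; apply: le_lt_trans.
rewrite (nneseries_split n 1)//.
rewrite addn1 big_nat1 leeDl//; by apply: nneseries_ge0 => k _ _.
Qed.

Lemma expRN1_le_half (R : realType) : expR (- 1) <= 2^-1 :> R.
Proof.
rewrite expRN lef_pV2 ?posrE ?expR_gt0//.
by have := expR_ge1Dx (1 : R); rewrite (_ : 1 + 1 = 2)//; ring.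
Qed.

(* At level [i] the sums have variance at most V / 16^i and there are at most
   exp (N (11 + 8 i)) of them; the bound is a union bound with exponential
   moments of order 4^i sqrt (N / V). *)
Lemma brownian_sums_ae (d : measure_display) (Omega : measurableType d) (R : realType)
    (P : probability Omega R) (B : nat -> R -> Omega -> R) (V : R)
    (J : nat -> nat -> nat) (a b : nat -> nat -> nat -> nat -> R) :
  brownian_family P B -> 0 < V ->
  (forall N i j k, 0 <= a N i j k) -> (forall N i j k, a N i j k <= b N i j k) ->
  (forall N i j, (j < J N i)%N -> \sum_(k < N) (b N i j k - a N i j k) <= V / 16 ^+ i) ->
  (forall N i, (0 < N)%N -> (J N i)%:R <= expR (N%:R * (11 + 8 * i%:R)) :> R) ->
  \forall w \ae P, exists N0, forall N, (N0 <= N)%N -> forall i j, (j < J N i)%N ->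
    `|\sum_(k < N) (B k (b N i j k) w - B k (a N i j k) w)| <=
    (14 + 9 * i%:R) / 4 ^+ i * Num.sqrt V * Num.sqrt N%:R.
Proof.
move=> BB V0 a0 ab abV JN; have [sbm _] := BB.
have b0 N i j k : 0 <= b N i j k by rewrite (le_trans (a0 N i j k)).
pose S N i j w := \sum_(k < N) (B k (b N i j k) w - B k (a N i j k) w).
have mS N i j : measurable_fun setT (S N i j).
  apply: measurable_sum => k; have [mB _ _ _] := sbm k.
  by apply: measurable_funB; exact: mB.
pose l N i : R := 4 ^+ i / Num.sqrt V * Num.sqrt N%:R.
have sV0 : 0 < Num.sqrt V by rewrite sqrtr_gt0.
have l0 N i : 0 <= l N i by rewrite mulr_ge0 ?sqrtr_ge0// divr_ge0 ?exprn_ge0 ?sqrtr_ge0.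
(* The number of sums costs N (11 + 8 i) and the exponential moment at most N; this exponent leaves
   exp (- N (2 + i)), summable over both i and N. *)
pose k_ N (i : nat) : R := N%:R * (14 + 9 * i%:R).
pose Z N i j w : R := expR (- k_ N i) * (expR (l N i * S N i j w) + expR (- l N i * S N i j w)).
have Z0 N i j w : 0 <= Z N i j w by rewrite mulr_ge0 ?addr_ge0 ?expR_ge0.
have mZ N i j : measurable_fun setT (Z N i j).
  apply: measurable_funM => //; apply: measurable_funD;
  by apply: measurableT_comp => //; exact: measurable_funM.
have EZ N i j : (j < J N i)%N -> (\int[P]_w (Z N i j w)%:E <= (2 * expR (N%:R - k_ N i))%:E)%E.
  move=> jJ; rewrite /Z.
  have mE (c : R) : measurable_fun setT (fun w => (expR (c * S N i j w))%:E).
    by apply/measurable_EFinP; apply: measurableT_comp => //; exact: measurable_funM.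
  under eq_integral do rewrite EFinM EFinD.
  rewrite ge0_integralZl//; last 2 first.
  - by apply: emeasurable_funD; exact: mE.
  - by move=> w _; rewrite -EFinD lee_fin addr_ge0 ?expR_ge0.
  rewrite ge0_integralD//; try (by move=> w _; rewrite lee_fin expR_ge0).
  rewrite !(brownian_sum_mgf _ N BB (a0 N i j) (ab N i j)) sqrrN -EFinD -EFinM lee_fin.
  have -> : 2 * expR (N%:R - k_ N i) = expR (- k_ N i) * (expR N%:R + expR N%:R).
    by rewrite expRD; ring.
  apply: ler_wpM2l; first exact: expR_ge0.
  have : l N i ^+ 2 * (\sum_(k < N) (b N i j k - a N i j k)) / 2 <= N%:R.
    have l2 : l N i ^+ 2 = 16 ^+ i / V * N%:R.
      rewrite !exprMn exprVn !sqr_sqrtr ?(ltW V0)// exprAC; congr (_ ^+ i / _ * _).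
      by rewrite expr2; lra.
    have : l N i ^+ 2 * (\sum_(k < N) (b N i j k - a N i j k)) <= N%:R.
      apply: le_trans (ler_wpM2l (sqr_ge0 _) (abV N i j jJ)) _.
      have p16 : (16 ^+ i : R) != 0 by rewrite expf_neq0// pnatr_eq0.
      rewrite l2; move: (16 ^+ i) p16 => c c0; have V1 : V != 0 by rewrite gt_eqF.
      by rewrite (_ : _ * _ = N%:R)//; field; rewrite c0.
    by have : 0 <= N%:R :> R by []; clear; lra.
  by move=> h; rewrite -ler_expR in h; exact: lerD.
(* All levels for N = n + 1 are collected in one variable, so that the threshold on N does not
   depend on the level. *)
pose Y n w : \bar R := (\sum_(0 <= i <oo) (\sum_(j < J n.+1 i) Z n.+1 i j w)%:E)%E.
have mY n : measurable_fun setT (Y n).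
  apply: ge0_emeasurable_sum => [i w _ _|i _]; first by rewrite lee_fin sumr_ge0.
  by apply/measurable_EFinP; apply: measurable_sum => j; exact: mZ.
have Y0 n w : (0 <= Y n w)%E.
  by apply: nneseries_ge0 => i _ _; rewrite lee_fin sumr_ge0.
have EY n : (\int[P]_w Y n w <= (4 * 2^-1 ^+ n)%:E)%E.
  rewrite integral_nneseries//; last 2 first.
  - by move=> i; apply/measurable_EFinP; apply: measurable_sum => j; exact: mZ.
  - by move=> i w _; rewrite lee_fin sumr_ge0.
  have -> : 4 * 2^-1 ^+ n = (2 * 2^-1 ^+ n) / (1 - 2^-1) :> R by field.
  apply: nneseries_geometric_le => // [|i|i].
    by rewrite invf_lt1// ltr1n.
    by apply: integral_ge0 => w _; rewrite lee_fin sumr_ge0.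
  under eq_integral do rewrite -sumEFin.
  rewrite ge0_integral_sum//; last 2 first.
  - by move=> j; apply/measurable_EFinP; exact: mZ.
  - by move=> j w _; rewrite lee_fin.
  apply: (@le_trans _ _ (\sum_(j < J n.+1 i) (2 * expR (n.+1%:R - k_ n.+1 i))%:E)%E).
    by apply: lee_sum => j _; exact: EZ.
  rewrite sumEFin lee_fin sumr_const card_ord -[X in X <= _]mulr_natl
    [X in X <= _]mulrCA -mulrA ler_wpM2l//.
  apply: (@le_trans _ _ (expR (n.+1%:R * (11 + 8 * i%:R)) * expR (n.+1%:R - k_ n.+1 i))).
    by rewrite ler_wpM2r ?expR_ge0// JN.
  rewrite -expRD.
  apply: (@le_trans _ _ (expR (- 1) ^+ (n + i))).
    rewrite -expRM_natl ler_expR /k_ natrD -natr1.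
    have := ler0n R n; have := ler0n R i; move: n%:R i%:R => x y; clear; nra.
  by rewrite -exprD lerXn2r ?nnegrE ?expR_ge0 ?invr_ge0// expRN1_le_half.
have half0 : 0 <= 2^-1 :> R by rewrite invr_ge0.
have half1 : 2^-1 < 1 :> R by rewrite invf_lt1// ltr1n.
apply: filterS (summable_expectation_ae half0 half1 mY Y0 EY) => w [n0 H].
exists n0.+1 => N; case: N => // n; rewrite ltnS => n0n i j jJ.
have Zlt : Z n.+1 i j w < 1.
  rewrite -lte_fin; apply: le_lt_trans (H n n0n); rewrite /Y.
  apply: (@le_trans _ _ (\sum_(j < J n.+1 i) Z n.+1 i j w)%:E).
    by rewrite lee_fin (bigD1 (Ordinal jJ))//= lerDl sumr_ge0.
  have Zs0 (k : nat) : (0 <= (\sum_(j < J n.+1 k) Z n.+1 k j w)%:E)%E.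
    by rewrite lee_fin sumr_ge0.
  rewrite (nneseries_split 0 i.+1)// add0n big_nat_recr//= -addeA addeCA leeDl//.
  by apply: adde_ge0; [apply: sume_ge0 => *|apply: nneseries_ge0 => *]; exact: Zs0.
have sN0 : 0 < Num.sqrt n.+1%:R :> R by rewrite sqrtr_gt0 ltr0n.
have lpos : 0 < l n.+1 i by rewrite /l mulr_gt0// divr_gt0// exprn_gt0.
have lS : l n.+1 i * `|S n.+1 i j w| <= k_ n.+1 i.
  apply: ltW; rewrite -subr_lt0 -ltr_expR expR0; apply: le_lt_trans Zlt.
  rewrite addrC expRD ler_wpM2l ?expR_ge0//.
  have [S0|S0] := leP 0 (S n.+1 i j w).
    by rewrite ger0_norm// lerDl expR_ge0.
  by rewrite ltr0_norm// mulrN -mulNr lerDr expR_ge0.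
rewrite -/(S n.+1 i j w) -(ler_pM2l lpos); apply: le_trans lS _.
rewrite /l /k_ le_eqVlt; apply/orP; left; apply/eqP.
have sNE : n.+1%:R = Num.sqrt n.+1%:R ^+ 2 :> R by rewrite sqr_sqrtr.
have p4 : (4 ^+ i : R) != 0 by rewrite expf_neq0// pnatr_eq0.
rewrite {1}sNE; move: (4 ^+ i) p4 (Num.sqrt V) sV0 (Num.sqrt _) => c c0 v v0 m.
by field; rewrite c0 gt_eqF.
Qed.

(** * Counting and rounding monotone paths *)

(** One term of the expansion of (1 + z)^n, and 1 + z <= e^z. *)
Lemma binomial_le_expR (R : realType) (z : R) (n m : nat) : 0 <= z -> (m <= n)%N ->
  'C(n, m)%:R * z ^+ m <= expR (n%:R * z).
Proof.
move=> z0 mn; rewrite expRM_natl.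
apply: (@le_trans _ _ ((1 + z) ^+ n)); last first.
  by rewrite lerXn2r ?nnegrE ?addr_ge0 ?expR_ge0// expR_ge1Dx.
rewrite exprDn; have mn' : (m < n.+1)%N by [].
rewrite (bigD1 (Ordinal mn'))//= expr1n mul1r mulr_natl lerDl sumr_ge0// => i _.
by rewrite expr1n mul1r mulrn_wge0// exprn_ge0.
Qed.

Lemma sixteen_le_expR4 (R : realType) : 16 <= expR 4 :> R.
Proof.
have e2 : 2 <= expR 1 :> R by have := expR_ge1Dx (1 : R); rewrite (_ : 1 + 1 = 2)//; ring.
have -> : 4 = 4%:R * 1 :> R by rewrite mulr1.
rewrite expRM_natl; apply: (@le_trans _ _ (2 ^+ 4)); first by rewrite !exprS expr0; lra.
by rewrite lerXn2r ?nnegrE ?expR_ge0.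
Qed.

(** Take z = 16^-(i+1): the exponent is at most 2 N + 1 <= 3 N, and dividing by z^(N+1) costs at
    most e^(4 (i+1) (N+1)) <= e^(8 N (i+1)). *)
Lemma binomial_grid_le (R : realType) (N i : nat) : (0 < N)%N ->
  'C(N.+1 + N * 16 ^ i.+1, N.+1)%:R <= expR (N%:R * (11 + 8 * i%:R)) :> R.
Proof.
move=> N0; have N1 : 1 <= N%:R :> R by rewrite ler1n.
pose z : R := 16^-1 ^+ i.+1.
have z0 : 0 < z by rewrite exprn_gt0 ?invr_gt0.
have z1 : z <= 1 by rewrite /z exprn_ile1 ?invr_ge0// invf_le1// ler1n.
have zE : z * 16 ^+ i.+1 = 1 by rewrite /z -exprMn mulVf ?expr1n// pnatr_eq0.
have := @binomial_le_expR _ z (N.+1 + N * 16 ^ i.+1) N.+1 (ltW z0) (leq_addr _ _).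
rewrite -ler_pdivlMr ?exprn_gt0// => /le_trans; apply.
have -> : (z ^+ N.+1)^-1 = 16 ^+ (i.+1 * N.+1).
  by rewrite /z -exprM exprVn invrK.
apply: (@le_trans _ _ (expR (3 * N%:R) * expR (N%:R * (8 + 8 * i%:R)))); last first.
  by rewrite -expRD ler_expR; have := ler0n R i; move: i%:R N%:R => x y; clear; nra.
apply: ler_pM; rewrite ?expR_ge0 ?exprn_ge0//.
  rewrite ler_expR natrD natrM natrX mulrDl -mulrA [16 ^+ _ * _]mulrC zE mulr1 -natr1.
  have : (N%:R + 1) * z <= N%:R + 1 by rewrite ler_piMr// addr_ge0.
  by clear -N1; lra.
apply: (@le_trans _ _ (expR 4 ^+ (i.+1 * N.+1))).
  by rewrite lerXn2r ?nnegrE ?expR_ge0// sixteen_le_expR4.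
rewrite -expRM_natl ler_expR natrM -!natr1.
by have := ler0n R i; move: i%:R N%:R N1 => x y y1 x0; clear -y1 x0; nra.
Qed.

(* Nonincreasing grid paths [m] are coded by the nondecreasing tuples M - m, so
   that their number is a binomial coefficient; [monotone_code N M j k] is the
   k-th entry of the j-th such tuple. *)
Definition monotone_codes (N M : nat) : {set N.+1.-tuple 'I_M.+1} :=
  [set t : N.+1.-tuple 'I_M.+1 | sorted leq [seq val i | i <- t]]%SET.

Definition monotone_code (N M j k : nat) : nat :=
  nth 0%N [seq val i | i <- nth [tuple of nseq N.+1 ord0]
    (enum (monotone_codes N M)) j : N.+1.-tuple 'I_M.+1] k.

Lemma card_monotone_codes N M : #|monotone_codes N M| = 'C(N.+1 + M, N.+1).
Proof. exact: card_sorted_tuples. Qed.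

Lemma monotone_codeP (N M : nat) (m : nat -> nat) :
  (forall k, (m k <= m k.+1)%N) -> (forall k, (m k <= M)%N) ->
  exists2 j, (j < 'C(N.+1 + M, N.+1))%N &
    forall k, (k <= N)%N -> monotone_code N M j k = m k.
Proof.
move=> mm mM.
pose t : N.+1.-tuple 'I_M.+1 := [tuple inord (m k) | k < N.+1].
have tE : [seq val i | i <- t] = [seq m k | k <- iota 0 N.+1].
  rewrite -val_enum_ord -map_comp; apply: etrans (esym (map_comp _ _ _)) _.
  by apply: eq_map => k; rewrite /= inordK// ltnS.
have tin : t \in monotone_codes N M.
  rewrite inE tE; apply: (homo_sorted (f := m) (e := leq)); last exact: iota_sorted.
  by apply: homo_leq => //; exact: leq_trans.
exists (index t (enum (monotone_codes N M))).
  by rewrite -card_monotone_codes cardE index_mem mem_enum.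
move=> k kN; rewrite /monotone_code nth_index ?mem_enum// tE.
by rewrite (nth_map 0%N) ?size_iota ?ltnS// nth_iota ?ltnS// add0n.
Qed.

Definition grid_point (R : realType) (T : R) (M f : nat) : R := T * f%:R / M%:R.

Lemma grid_point_ge0 (R : realType) (T : R) (M f : nat) : 0 <= T -> 0 <= grid_point T M f.
Proof. by move=> T0; rewrite divr_ge0// mulr_ge0. Qed.

Lemma grid_point_le (R : realType) (T : R) (M f g : nat) : 0 <= T -> (f <= g)%N ->
  grid_point T M f <= grid_point T M g.
Proof. by move=> T0 fg; rewrite ler_wpM2r ?invr_ge0// ler_wpM2l// ler_nat. Qed.

Lemma grid_point_parent (R : realType) (T : R) (M f : nat) : 0 <= T ->
  0 <= grid_point T (M * 16) f - grid_point T M (f %/ 16) <= T / M%:R.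
Proof.
move=> T0; case: (posnP M) => [->|M0].
  by rewrite /grid_point mul0n invr0 !mulr0 subrr lexx.
have M0' : 0 < M%:R :> R by rewrite ltr0n.
have -> : grid_point T (M * 16) f - grid_point T M (f %/ 16) =
    T / M%:R * ((f %% 16)%:R / 16).
  rewrite /grid_point {1}(divn_eq f 16) natrD !natrM.
  by field; rewrite gt_eqF.
have q0 : 0 <= T / M%:R by rewrite divr_ge0// ltW.
rewrite mulr_ge0 ?divr_ge0//= ler_piMr// ler_pdivrMr// mul1r.
by rewrite ler_nat ltnW// ltn_mod.
Qed.

Definition grid_floor (R : realType) (T : R) (M : nat) (s : R) : nat :=
  Num.truncn (s * M%:R / T).

(** Thus a refinement step is determined by the finer rounded path alone, and counting the finer
    paths counts the steps. *)
Lemma grid_floor_parent (R : realType) (T : R) (M : nat) (s : R) : 0 < T -> 0 <= s ->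
  (grid_floor T (M * 16) s %/ 16)%N = grid_floor T M s.
Proof.
move=> T0 s0; apply/esym; apply: truncn_def.
have x0 : 0 <= s * M%:R / T by rewrite divr_ge0 ?mulr_ge0// ltW.
have xE : s * (M * 16)%:R / T = 16 * (s * M%:R / T).
  by rewrite natrM; field; rewrite gt_eqF.
have := @truncn_itv _ (s * (M * 16)%:R / T); rewrite {1}xE mulr_ge0// => /(_ isT).
rewrite /grid_floor; set n := Num.truncn _; rewrite xE; move: (s * M%:R / T) => x.
have nE : n%:R = 16 * (n %/ 16)%:R + (n %% 16)%:R :> R.
  by rewrite {1}(divn_eq n 16) natrD natrM mulrC.
have r16 : (n %% 16)%:R + 1 <= 16 :> R by rewrite natr1 ler_nat ltn_mod.
have r0 : 0 <= (n %% 16)%:R :> R by [].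
rewrite -[n.+1%:R]natr1 -[(n %/ 16).+1%:R]natr1 nE.
move: (n %/ 16)%:R (n %% 16)%:R r16 r0 => a b h1 h2 /andP[h3 h4].
by move: h1 h2 h3 h4; clear=> h1 h2 h3 h4; apply/andP; split; lra.
Qed.

Lemma grid_floor_le (R : realType) (T : R) (M : nat) (s : R) : 0 < T -> 0 <= s -> s <= T ->
  (grid_floor T M s <= M)%N.
Proof.
move=> T0 s0 sT; rewrite -(ler_nat R); apply: (@le_trans _ _ (s * M%:R / T)).
  by rewrite truncn_le divr_ge0 ?mulr_ge0// ltW.
by rewrite ler_pdivrMr// mulrC ler_wpM2l.
Qed.

Lemma grid_floor_homo (R : realType) (T : R) (M : nat) (s t : R) : 0 < T -> s <= t ->
  (grid_floor T M s <= grid_floor T M t)%N.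
Proof.
by move=> T0 st; apply: le_truncn; rewrite ler_wpM2r ?invr_ge0 ?(ltW T0)// ler_wpM2r.
Qed.

Lemma grid_point_floor (R : realType) (T : R) (M : nat) (s : R) : 0 < T -> (0 < M)%N ->
  0 <= s -> 0 <= s - grid_point T M (grid_floor T M s) <= T / M%:R.
Proof.
move=> T0 M0 s0; have M0' : 0 < M%:R :> R by rewrite ltr0n.
have x0 : 0 <= s * M%:R / T by rewrite divr_ge0 ?mulr_ge0// ltW.
have /andP[] := truncn_itv x0; rewrite -natr1 /grid_floor /grid_point.
move: (Num.truncn _)%:R => n.
rewrite ler_pdivlMr// ltr_pdivrMr// => h1 h2.
rewrite subr_ge0 ler_pdivrMr// mulrC h1/= lerBlDr -mulrDl ler_pdivlMr//.
by move: (s * M%:R) h2 => y; clear; lra.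
Qed.

Lemma cvg_ord_sum (R : realType) (n : nat) (f : nat -> nat -> R) (l : nat -> R) :
  (forall k, (k < n)%N -> f k i @[i --> \oo] --> l k) ->
  (\sum_(k < n) f k i) @[i --> \oo] --> \sum_(k < n) l k.
Proof.
elim: n => [|n IH] H.
  by rewrite big_ord0; under eq_fun do rewrite big_ord0; exact: cvg_cst.
rewrite big_ord_recr; under eq_fun do rewrite big_ord_recr.
by apply: cvgD; [apply: IH => k kn; exact: H (ltnW kn)|exact: H].
Qed.

Lemma nonneg_continuous_grid (R : realType) (f : R -> R) (T s : R) (N : nat) :
  nonneg_continuous f -> 0 < T -> (0 < N)%N -> 0 <= s ->
  f (grid_point T (N * 16 ^ i) (grid_floor T (N * 16 ^ i) s)) @[i --> \oo] --> f s.
Proof.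
move=> cf T0 N0 s0; apply/cvgrPdist_lt => e e0.
have [d d0 H] := cf s e s0 e0.
exists (Num.truncn (T / d)).+1 => // i /= iT.
rewrite distrC; apply: H; first by rewrite grid_point_ge0// ltW.
have M0 : (0 < N * 16 ^ i)%N by rewrite muln_gt0 N0 expn_gt0.
have /andP[h0 h1] := grid_point_floor T0 M0 s0.
rewrite distrC ger0_norm//; apply: le_lt_trans h1 _.
rewrite ltr_pdivrMr ?ltr0n// mulrC -ltr_pdivrMr//.
apply: lt_le_trans (truncnS_gt _) _; rewrite ler_nat.
apply: leq_trans iT _; apply: (@leq_trans (16 ^ i)); last by rewrite leq_pmull.
exact/ltnW/ltn_expl.
Qed.

Lemma four_pow_weight_le (R : realType) (i : nat) :
  (14 + 9 * i%:R) / 4 ^+ i <= 14 * 2^-1 ^+ i :> R.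
Proof.
have p2 : 0 < 2 ^+ i :> R by exact: exprn_gt0.
have -> : 4 ^+ i = 2 ^+ i * 2 ^+ i :> R by rewrite -exprMn; congr (_ ^+ i); lra.
have : i%:R + 1 <= 2 ^+ i :> R by rewrite natr1 -natrX ler_nat ltn_expl.
rewrite exprVn; move: (2 ^+ i) p2 => c c0 h.
rewrite ler_pdivrMr ?mulr_gt0// -[14 / c * _]mulrA [c^-1 * _]mulrA mulVf ?gt_eqF// mul1r.
by have := ler0n R i; move: h; clear; lra.
Qed.

Lemma monotone_code_nondecreasing (N M j k : nat) : (j < 'C(N.+1 + M, N.+1))%N -> (k < N)%N ->
  (monotone_code N M j k <= monotone_code N M j k.+1)%N.
Proof.
move=> jC kN; rewrite /monotone_code.
set t : N.+1.-tuple 'I_M.+1 := nth _ _ _.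
have : t \in monotone_codes N M.
  by rewrite -mem_enum; apply: mem_nth; rewrite -cardE card_monotone_codes.
rewrite inE => /(sortedP 0%N); apply.
by rewrite size_map size_tuple ltnS.
Qed.

(** Only level 0 of [brownian_sums_ae] is populated, with V = T: time steps along a monotone path
    telescope to at most T. *)
Lemma base_sums_ae (d : measure_display) (Omega : measurableType d) (R : realType)
    (P : probability Omega R) (B : nat -> R -> Omega -> R) (T : R) :
  brownian_family P B -> 0 < T ->
  \forall w \ae P, exists N0, forall N, (N0 <= N)%N ->
    forall m : nat -> nat, (forall k, (m k.+1 <= m k)%N) -> (forall k, (m k <= N)%N) ->
    `|\sum_(k < N) (B k (grid_point T N (m k)) w - B k (grid_point T N (m k.+1)) w)| <=
    14 * Num.sqrt T * Num.sqrt N%:R.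
Proof.
move=> BB T0; have T0' := ltW T0.
pose b N (i : nat) j k := grid_point T N (N - monotone_code N N j k).
(* The minimum secures a <= b also for indices that code no path; on a code it is the next grid
   time. *)
pose a N (i : nat) j k := Num.min (b N i j k.+1) (b N i j k).
pose J N i := if i == 0%N then 'C(N.+1 + N, N.+1) else 0%N.
have b0 N i j k : 0 <= b N i j k by exact: grid_point_ge0.
have a0 N i j k : 0 <= a N i j k by rewrite le_min !b0.
have ab N i j k : a N i j k <= b N i j k by rewrite ge_min lexx orbT.
have aE N i j k : (j < J N i)%N -> (k < N)%N -> a N i j k = b N i j k.+1.
  rewrite /J; case: eqP => // _ jC kN; apply: min_l; apply: grid_point_le => //.
  by apply: leq_sub2l; exact: monotone_code_nondecreasing.
have sumab N i j : (j < J N i)%N -> \sum_(k < N) (b N i j k - a N i j k) <= T / 16 ^+ i.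
  case: i => [|i] jJ; last by move: jJ; rewrite /J ltn0.
  rewrite expr0 divr1.
  rewrite (eq_bigr (fun k : 'I_N => - (b N 0%N j k.+1 - b N 0%N j k))); last first.
    by move=> k _; rewrite aE// opprB.
  rewrite sumrN -(big_mkord predT (fun k => b N 0%N j k.+1 - b N 0%N j k)) telescope_sumr//.
  rewrite opprB lerBlDr ler_wpDr//.
  apply: (@le_trans _ _ (grid_point T N N)); first by apply: grid_point_le => //; exact: leq_subr.
  rewrite /grid_point; have [->|N0] := eqVneq N%:R (0 : R); first by rewrite invr0 mulr0.
  by rewrite mulfK.
have JN N i : (0 < N)%N -> (J N i)%:R <= expR (N%:R * (11 + 8 * i%:R)) :> R.
  move=> N0; rewrite /J; case: eqP => [->|_]; last by rewrite expR_ge0.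
  have := @binomial_le_expR R 1 (N.+1 + N) N.+1 ler01 (leq_addr _ _).
  rewrite expr1n mulr1 mulr1 => /le_trans; apply; rewrite ler_expR mulr0 addr0 natrD -natr1.
  have : 1 <= N%:R :> R by rewrite ler1n.
  by clear; lra.
apply: filterS (brownian_sums_ae BB T0 a0 ab sumab JN) => w [N0 H].
exists N0 => N NN m mm mN.
have [|k|j jC Hj] := @monotone_codeP N N (fun k => N - m k)%N.
- by move=> k; apply: leq_sub2l; exact: mm.
- exact: leq_subr.
have jJ : (j < J N 0%N)%N by rewrite /J eqxx.
have := H N NN 0%N j jJ; rewrite mulr0 addr0 expr0 divr1.
congr (`|_| <= _); apply: eq_bigr => k _.
have bE k' : (k' <= N)%N -> b N 0%N j k' = grid_point T N (m k').
  by move=> kN; rewrite /b Hj// subKn.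
by rewrite aE// !bE// ltnW.
Qed.

(** The values h = 0 and h = 1 refine the two end times s_k and s_(k+1) of the k-th increment. N
    shifts by at most T / (N 16^i) give variance at most T / 16^i. *)
Lemma refinement_sums_ae (d : measure_display) (Omega : measurableType d) (R : realType)
    (P : probability Omega R) (B : nat -> R -> Omega -> R) (T : R) (h : nat) :
  brownian_family P B -> 0 < T -> (h <= 1)%N ->
  \forall w \ae P, exists N0, forall N, (N0 <= N)%N ->
    forall (i : nat) (m : nat -> nat), (forall k, (m k.+1 <= m k)%N) ->
      (forall k, (m k <= N * 16 ^ i * 16)%N) ->
    `|\sum_(k < N) (B k (grid_point T (N * 16 ^ i * 16) (m (k + h)%N)) w
                  - B k (grid_point T (N * 16 ^ i) (m (k + h)%N %/ 16)) w)| <=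
    (14 + 9 * i%:R) / 4 ^+ i * Num.sqrt T * Num.sqrt N%:R.
Proof.
move=> BB T0 h1; have T0' := ltW T0.
pose M N i := (N * 16 ^ i * 16)%N.
pose c N i j k := (M N i - monotone_code N (M N i) j (k + h))%N.
pose b N (i : nat) j k := grid_point T (M N i) (c N i j k).
pose a N (i : nat) j k := grid_point T (N * 16 ^ i) (c N i j k %/ 16).
pose J N i := 'C(N.+1 + M N i, N.+1).
have a0 N i j k : 0 <= a N i j k by exact: grid_point_ge0.
have ab N i j k : a N i j k <= b N i j k.
  by rewrite -subr_ge0; have /andP[] := grid_point_parent (N * 16 ^ i) (c N i j k) T0'.
have sumab N i j : (j < J N i)%N -> \sum_(k < N) (b N i j k - a N i j k) <= T / 16 ^+ i.
  move=> _; have [->|N0] := posnP N.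
    by rewrite big_ord0 divr_ge0// exprn_ge0.
  apply: (@le_trans _ _ (\sum_(k < N) T / (N * 16 ^ i)%:R)).
    apply: ler_sum => k _.
    by have /andP[_] := grid_point_parent (N * 16 ^ i) (c N i j k) T0'.
  have N1 : (N%:R : R) != 0 by rewrite pnatr_eq0 -lt0n.
  have p16 : (16 ^+ i : R) != 0 by rewrite expf_neq0// pnatr_eq0.
  rewrite sumr_const card_ord -[X in X <= _]mulr_natr natrM natrX.
  move: (16 ^+ i) p16 (N%:R : R) N1 => y y0 z z0.
  by rewrite (_ : T / (z * y) * z = T / y)//; field; rewrite y0.
have JN N i : (0 < N)%N -> (J N i)%:R <= expR (N%:R * (11 + 8 * i%:R)) :> R.
  by move=> N0; have := @binomial_grid_le R N i N0; rewrite expnSr mulnA.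
apply: filterS (brownian_sums_ae BB T0 a0 ab sumab JN) => w [N0 H].
exists N0 => N NN i m mm mN.
have [|k|j jC Hj] := @monotone_codeP N (M N i) (fun k => M N i - m k)%N.
- by move=> k; apply: leq_sub2l; exact: mm.
- exact: leq_subr.
have := H N NN i j jC; congr (`|_| <= _); apply: eq_bigr => k _.
have khN : (k + h <= N)%N.
  by apply: leq_trans (leq_add (leqnn _) h1) _; rewrite addn1.
have cE : c N i j k = m (k + h)%N by rewrite /c Hj// subKn.
by rewrite /b /a cE.
Qed.

(* Chaining: the path is rounded to the grids of mesh T / (N 16^i).  The base
   grid contributes O(sqrt N) because the increments along a monotone path have
   total variance at most T; each refinement moves every time by at most
   T / (N 16^i). *)
Lemma path_noise_ae (d : measure_display) (Omega : measurableType d) (R : realType)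
    (P : probability Omega R) (B : nat -> R -> Omega -> R) (T : R) :
  brownian_family P B -> 0 < T ->
  \forall w \ae P, exists N0, forall N, (N0 <= N)%N ->
    path_noise_bounded (fun k t => B k t w) T (70 * Num.sqrt T) N.
Proof.
move=> BB T0; have T0' := ltW T0; have [sbm _] := BB.
have cB : \forall w \ae P, forall k, {within `[0, +oo[, continuous (fun t => B k t w)}.
  apply: ae_foralln => k; have [_ cB _ _] := sbm k.
  by apply: filterS cB => w [].
have Bs := base_sums_ae BB T0.
have Ls := refinement_sums_ae BB T0 (leq0n 1).
have Rs := refinement_sums_ae BB T0 (leqnn 1).
apply: filterS (filterI cB (filterI Bs (filterI Ls Rs))) => w.
move=> [{}cB [[N1 {}Bs] [[N2 {}Ls] [N3 {}Rs]]]].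
exists (N1 + N2 + N3).+1 => N NN s sS s0T.
have N0 : (0 < N)%N by exact: leq_ltn_trans NN.
have sT k : 0 <= s k /\ s k <= T.
  split; first by have /andP[h1 h2] := sS k; exact: le_trans h2.
  by elim: k => // k; have /andP[_ h] := sS k; exact: le_trans.
pose m i k := grid_floor T (N * 16 ^ i) (s k).
have mm i k : (m i k.+1 <= m i k)%N by apply: grid_floor_homo => //; have /andP[] := sS k.
have mM i k : (m i k <= N * 16 ^ i)%N by have [? ?] := sT k; exact: grid_floor_le.
have mpar i k : (m i.+1 k %/ 16)%N = m i k.
  by have [? ?] := sT k; rewrite /m expnSr mulnA grid_floor_parent.
pose g i k := grid_point T (N * 16 ^ i) (m i k).
pose D i := \sum_(k < N) (B k (g i k.+1) w - B k (g i k) w).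
set c := Num.sqrt T * Num.sqrt N%:R.
have c0 : 0 <= c by rewrite mulr_ge0 ?sqrtr_ge0.
have [N1N N2N N3N] : [/\ (N1 <= N)%N, (N2 <= N)%N & (N3 <= N)%N].
  by clear -NN; split; lia.
have mM0 k : (m 0%N k <= N)%N by have := mM 0%N k; rewrite expn0 muln1.
have D0 : `|D 0%N| <= 14 * c.
  have := Bs N N1N (m 0%N) (mm 0%N) mM0.
  rewrite -mulrA -/c -normrN -sumrN.
  by congr (`|_| <= _); apply: eq_bigr => k _; rewrite opprB /g expn0 muln1.
have DS i : `|D i.+1 - D i| <= 2 * (14 * 2^-1 ^+ i * c).
  have mM' k : (m i.+1 k <= N * 16 ^ i * 16)%N by rewrite -mulnA -expnSr.
  have HL := Ls N N2N i (m i.+1) (mm i.+1) mM'.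
  have HR := Rs N N3N i (m i.+1) (mm i.+1) mM'.
  have w0 := ler_wpM2r c0 (four_pow_weight_le R i).
  rewrite -mulrA -/c in HL; rewrite -mulrA -/c in HR.
  have -> : D i.+1 - D i =
    \sum_(k < N) (B k (grid_point T (N * 16 ^ i * 16) (m i.+1 (k + 1)%N)) w
      - B k (grid_point T (N * 16 ^ i) (m i.+1 (k + 1)%N %/ 16)) w) -
    \sum_(k < N) (B k (grid_point T (N * 16 ^ i * 16) (m i.+1 (k + 0)%N)) w
      - B k (grid_point T (N * 16 ^ i) (m i.+1 (k + 0)%N %/ 16)) w).
    rewrite /D -!sumrB; apply: eq_bigr => k _.
    by rewrite addn1 addn0 !mpar /g expnSr mulnA; ring.
  apply: le_trans (ler_normB _ _) _.
  by move: HL HR w0; clear; lra.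
(* 14 from the base grid, then 28 / 2^i from level i for the two end times: 14 + 56 = 70 in the
   limit. *)
have Dle i : `|D i| <= (70 - 56 * 2^-1 ^+ i) * c.
  elim: i => [|i IH]; first by apply: le_trans D0 _; rewrite expr0; move: c0; clear; lra.
  have := ler_normD (D i.+1 - D i) (D i); rewrite subrK => /le_trans; apply.
  by have := DS i; move: IH; rewrite exprS; move: (2^-1 ^+ i) => y; clear; lra.
(* The rounded times converge to the [s k]; continuity of the trajectories carries the bound over to
   the path itself. *)
have cvD : D i @[i --> \oo] --> \sum_(k < N) (B k (s k.+1) w - B k (s k) w).
  apply: (@cvg_ord_sum R N (fun k i => B k (g i k.+1) w - B k (g i k) w)
    (fun k => B k (s k.+1) w - B k (s k) w)) => k kN.
  have cBk := within_nonneg_continuous (cB k).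
  have [sk0 _] := sT k; have [sk1 _] := sT k.+1.
  by apply: cvgB; [exact: (nonneg_continuous_grid cBk T0 N0 sk1)|
                   exact: (nonneg_continuous_grid cBk T0 N0 sk0)].
rewrite -mulrA -/c.
have cvD' : `|D i| @[i --> \oo] --> `|\sum_(k < N) (B k (s k.+1) w - B k (s k) w)|.
  exact: cvg_norm.
rewrite -(cvg_lim _ cvD')//; apply: limr_le; [exact: cvgP cvD'|apply: nearW => i].
apply: le_trans (Dle i) _.
by rewrite ler_wpM2r// gerBl mulr_ge0// exprn_ge0// invr_ge0.
Qed.

(** * Descending paths with large gain *)

(** The coefficient of [f k] in [expavg r f s]. *)
Fixpoint expwt (R : realType) (r : R) (s k : nat) : R :=
  if s is s'.+1 then r * expwt r s' k + (1 - r) * (k == s)%:R else (k == 0%N)%:R.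

Lemma expwt_gt (R : realType) (r : R) (s k : nat) : (s < k)%N -> expwt r s k = 0.
Proof.
elim: s => [|s IH] sk /=; first by case: k sk.
by rewrite IH ?(ltnW sk)// gtn_eqF// !mulr0 addr0.
Qed.

Lemma expavg_sum (R : realType) (r : R) (f : nat -> R) (s N : nat) : (s < N)%N ->
  expavg r f s = \sum_(k < N) expwt r s k * f k.
Proof.
have delta (m : nat) : (m < N)%N -> \sum_(k < N) (val k == m)%:R * f k = f m.
  move=> mN; rewrite (bigD1 (Ordinal mN))//= eqxx mul1r big1 ?addr0// => k.
  by rewrite -val_eqE/= => /negbTE ->; rewrite mul0r.
elim: s => [|s IH] sN /=; first by rewrite delta.
rewrite (IH (ltnW sN)) -(delta _ sN) !mulr_sumr -big_split/=.
by apply: eq_bigr => k _; ring.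
Qed.

Lemma expwt_bounds (R : realType) (r : R) (s k : nat) : 0 <= r <= 1 -> 0 <= expwt r s k <= 1.
Proof.
move=> /andP[r0 r1]; elim: s => [|s /andP[IH0 IH1]] /=; first by case: eqP; rewrite ?lexx ler01.
have b0 : 0 <= (k == s.+1)%:R :> R by [].
have b1 : (k == s.+1)%:R <= 1 :> R by case: eqP.
have r1' : 0 <= 1 - r by rewrite subr_ge0.
rewrite addr_ge0 ?mulr_ge0//=.
have := ler_wpM2l r0 IH1; have := ler_wpM2l r1' b1.
by clear; lra.
Qed.

Lemma sum_expwt_sqr_le (R : realType) (r : R) (s N : nat) : 0 <= r <= 1 -> (s < N)%N ->
  \sum_(k < N) expwt r s k ^+ 2 <= 1.
Proof.
move=> r01 sN; apply: (@le_trans _ _ (\sum_(k < N) expwt r s k * 1)).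
  apply: ler_sum => k _; have /andP[w0 w1] := expwt_bounds s k r01.
  by rewrite expr2 ler_wpM2l.
rewrite -(expavg_sum r (fun=> 1) sN).
by apply: expavg_le.
Qed.

Lemma probability_indic_increment (d : measure_display) (Omega : measurableType d) (R : realType)
    (P : probability Omega R) (xi : Omega -> R) (A : set R) (s : R) :
  measurable_fun setT xi -> measurable A ->
  (forall A : set R, measurable A -> P (xi @^-1` A) = normal_prob 0 s A) ->
  (\int[P]_w (\1_A (xi w))%:E = (fine (normal_prob 0 s A))%:E)%E.
Proof.
move=> mxi mA law.
have mxA : measurable (xi @^-1` A) by rewrite -[X in measurable X]setTI; exact: mxi.
rewrite -(law A mA) fineK; last exact: fin_num_measure.
by apply: etrans (integral_indic P measurableT mxA) _; rewrite setIT.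
Qed.

(** For e in [0, 1], e^(-e) <= 1 / (1 + e) <= 1 - e / 2, so the mixture is at most 1 - dl e / 2. *)
Lemma exp_gain_factor_le (R : realType) (a dl pi_ e : R) : 0 <= dl -> dl <= pi_ -> pi_ <= 1 ->
  0 <= e -> e <= 1 ->
  expR a * (pi_ * expR (- e) + (1 - pi_)) <= expR (a - dl * e / 2).
Proof.
move=> dl0 dlpi pi1 e0 e1; rewrite expRD ler_wpM2l ?expR_ge0//.
apply: le_trans (expR_ge1Dx _).
have eN : expR (- e) <= (1 + e)^-1.
  by rewrite expRN lef_pV2 ?posrE ?expR_gt0 ?expR_ge1Dx//; lra.
have e2 : (1 + e)^-1 <= 1 - e / 2.
  rewrite -[leLHS]mul1r ler_pdivrMr; last by lra.
  by nra.
have : pi_ * expR (- e) <= pi_ * (1 - e / 2).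
  by rewrite ler_wpM2l ?(le_trans eN)// (le_trans dl0).
have : dl * e <= pi_ * e by rewrite ler_wpM2r.
by clear; lra.
Qed.

(* During the j-th time block the descending path stays at [gain_site N j], or
   one site above it if the increment of that upper particle over the block is at
   most - sqrt h.  [gain_weight] sums over all 2^N patterns of such choices: it
   has a product form in expectation and dominates the term of the actual one. *)
Definition gain_site (N j : nat) : nat := (N - j.+1).*2.

Definition gain_set (R : realType) (h : R) (b : bool) : set R :=
  if b then `]-oo, - Num.sqrt h]%classic else ~` `]-oo, - Num.sqrt h]%classic.

(** The average at the upper site is r times the one at [gain_site] plus (1 - r) times the increment
    of the upper particle. When that site is chosen, the increment is at most - sqrt h and is
    replaced by this bound in [gain_shift]. The upper particle then enters through an indicator
    only, its weight at [gain_site] being 0. *)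
Definition gain_factor (R : realType) (r l h : R) (N : nat) (b : bool) (k j : nat) (y : R) : R :=
  \1_(if k == (gain_site N j).+1 then gain_set h b else setT) y *
  expR (l * ((if b then r else 1) * expwt r (gain_site N j) k) * y).

Definition gain_shift (R : realType) (r l h : R) (b : bool) : R :=
  if b then expR (- (l * ((1 - r) * Num.sqrt h))) else 1.

Definition ffun_ext (N : nat) (sg : {ffun 'I_N -> bool}) (j : nat) : bool :=
  oapp sg false (insub j).

Definition gain_weight (R : realType) (r l h : R) (N : nat) (xi : nat -> nat -> R) : R :=
  \sum_(sg : {ffun 'I_N -> bool}) (\prod_(j < N) gain_shift r l h (sg j)) *
    \prod_(k < N.*2) \prod_(j < N) gain_factor r l h N (ffun_ext sg j) k j (xi k j).

Lemma ffun_extE (N : nat) (sg : {ffun 'I_N -> bool}) (j : 'I_N) : ffun_ext sg j = sg j.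
Proof. by rewrite /ffun_ext valK. Qed.

Lemma gain_factor_ge0 (R : realType) (r l h : R) N b k j y : 0 <= gain_factor r l h N b k j y.
Proof. by rewrite mulr_ge0 ?expR_ge0. Qed.

Lemma gain_shift_ge0 (R : realType) (r l h : R) b : 0 <= gain_shift r l h b.
Proof. by rewrite /gain_shift; case: b; rewrite ?expR_ge0. Qed.

Lemma gain_site_lt (N j : nat) : (j < N)%N -> ((gain_site N j).+1 < N.*2)%N.
Proof. by move=> jN; rewrite /gain_site; lia. Qed.

Lemma gain_weight_path (R : realType) (r l h : R) (N : nat) (xi : nat -> nat -> R) :
  0 <= r <= 1 -> 0 <= l -> (0 < N)%N ->
  exists m : nat -> nat, [/\ (forall j, (j < N)%N -> (m j.+1 <= m j)%N), (m 0%N < N.*2)%N &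
    expR (l * \sum_(j < N) expavg r (xi^~ j) (m j)) <= gain_weight r l h N xi].
Proof.
move=> r01 l0 N0; have /andP[r0 r1] := r01.
pose chi j := xi (gain_site N j).+1 j <= - Num.sqrt h.
pose m j := if (j < N)%N then (gain_site N j + chi j)%N else 0%N.
exists m; split.
(* Successive sites differ by two, so the path descends even when the next block uses its upper
   neighbour. *)
- by move=> j jN; rewrite /m jN /gain_site; case: ifP => // jN'; lia.
- by rewrite /m N0 /gain_site; lia.
pose sg : {ffun 'I_N -> bool} := [ffun j : 'I_N => chi j].
rewrite /gain_weight (bigD1 sg)//=; apply: ler_wpDr.
  apply: sumr_ge0 => s _; rewrite mulr_ge0//.
    by apply: prodr_ge0 => j _; exact: gain_shift_ge0.
  by apply: prodr_ge0 => k _; apply: prodr_ge0 => j _; exact: gain_factor_ge0.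
rewrite exchange_big/= -big_split/= mulr_sumr expR_sum.
apply: ler_prod => j _; rewrite expR_ge0/= ffun_extE ffunE.
have jN := ltn_ord j; have sN := gain_site_lt jN; have sN' := ltnW sN.
set s := gain_site N j in sN sN' *.
have -> : \prod_(k < N.*2) gain_factor r l h N (chi j) k j (xi k j) =
    expR (l * ((if chi j then r else 1) * expavg r (xi^~ j) s)).
  rewrite (expavg_sum r _ sN') !mulr_sumr expR_sum; apply: eq_bigr => k _.
  rewrite /gain_factor -/s; have [ks|_] := eqVneq (val k) s.+1; last first.
    by rewrite indicT mul1r !mulrA.
  rewrite ks indicE mem_set ?mul1r ?mulrA// /gain_set /chi -/s.
  by case: ifP => [H|/negbT H]; rewrite /= in_itv//=; apply/negP.
rewrite /m jN -/s; case: ifP => [cj|_]; rewrite /gain_shift ?cj.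
  rewrite addn1 /= -expRD ler_expR -mulrN -mulrDr ler_wpM2l// addrC lerD2r.
  by rewrite -mulrN ler_wpM2l// subr_ge0.
by rewrite addn0 !mul1r.
Qed.

(** For a fixed pattern, each block contributes at most the probability of its choice times e^(l^2 h
    / 2), as the squared weights sum to at most 1. Summing these products over all patterns gives
    the N-th power of a two-term sum. *)
Lemma gain_weight_expectation (d : measure_display) (Omega : measurableType d) (R : realType)
    (P : probability Omega R) (B : nat -> R -> Omega -> R) (r l h T pi_ : R) (N : nat) :
  brownian_family P B -> 0 <= T -> 0 < h -> 0 <= r <= 1 ->
  pi_ = fine (normal_prob 0 (Num.sqrt h) (gain_set h true)) ->
  (\int[P]_w (gain_weight r l h N
     (fun k j => B k (T + j.+1%:R * h) w - B k (T + j%:R * h) w))%:E <=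
   ((expR (l ^+ 2 * h / 2) * (pi_ * expR (- (l * ((1 - r) * Num.sqrt h))) + (1 - pi_))) ^+ N)%:E)%E.
Proof.
move=> BB T0 h0 r01 piE; have /andP[r0 r1] := r01; have [sbm _] := BB.
pose tau (j : nat) : R := T + j%:R * h.
have tau0 : 0 <= tau 0%N by rewrite /tau mul0r addr0.
have tauS j : tau j.+1 - tau j = h by rewrite /tau -natr1; ring.
have taul j : tau j <= tau j.+1 by rewrite -subr_ge0 tauS ltW.
have taup j : 0 <= tau j by rewrite addr_ge0// mulr_ge0// ltW.
have mB k t : 0 <= t -> measurable_fun setT (B k t) by have [+ _ _ _] := sbm k; apply.
have mxi k j : measurable_fun setT (fun w => B k (tau j.+1) w - B k (tau j) w).
  by apply: measurable_funB; exact: mB.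
have mset b : measurable (gain_set h b).
  by rewrite /gain_set; case: b => //; exact: measurableC.
have law k j (A : set R) : measurable A ->
    P ((fun w => B k (tau j.+1) w - B k (tau j) w) @^-1` A) = normal_prob 0 (Num.sqrt h) A.
  move=> mA; have [_ _ lw _] := sbm k.
  by have := lw (tau j) (tau j.+1) (taup j); rewrite -subr_gt0 tauS => /(_ h0 A mA).
pose p_ b := fine (normal_prob 0 (Num.sqrt h) (gain_set h b)).
have p_0 b : 0 <= p_ b by exact: fine_ge0.
pose c b : R := if b then r else 1.
have c01 b : 0 <= c b <= 1 by rewrite /c; case: b; rewrite ?r0// lexx ler01.
pose e b k j : R := if k == (gain_site N j).+1 then p_ b
  else expR ((l * (c b * expwt r (gain_site N j) k)) ^+ 2 * h / 2).
have e0 b k j : 0 <= e b k j by rewrite /e; case: ifP => _; rewrite ?expR_ge0.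
have mf b k j : measurable_fun setT (gain_factor r l h N b k j).
  apply: measurable_funM.
    by apply: measurable_indic; case: ifP => _; [exact: mset|exact: measurableT].
  by apply: measurableT_comp => //; exact: measurable_funM.
have fe b k j : (\int[P]_w (gain_factor r l h N b k j (B k (tau j.+1) w - B k (tau j) w))%:E =
    (e b k j)%:E)%E.
  rewrite /gain_factor /e; case: eqP => [->|_].
    under eq_integral do rewrite expwt_gt// !mulr0 mul0r expR0 mulr1.
    by rewrite (probability_indic_increment (mxi _ j) (mset b) (law _ j)).
  under eq_integral do rewrite indicT mul1r.
  by rewrite (brownian_increment_mgf _ (sbm k) (taup j) (taul j)) tauS.
have lh0 : 0 <= l ^+ 2 * h / 2.
  by apply: divr_ge0 => //; apply: mulr_ge0; [exact: sqr_ge0|exact: ltW].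
have colbound b j : (j < N)%N -> \prod_(k < N.*2) e b k j <= p_ b * expR (l ^+ 2 * h / 2).
  move=> jN; rewrite (bigD1 (Ordinal (gain_site_lt jN)))//= {1}/e eqxx ler_wpM2l//.
  rewrite (eq_bigr (fun k : 'I_(N.*2) =>
      expR ((l * (c b * expwt r (gain_site N j) k)) ^+ 2 * h / 2))); last first.
    by move=> k; rewrite -val_eqE/= /e => /negbTE ->.
  rewrite -expR_sum ler_expR.
  apply: (@le_trans _ _ (\sum_(k < N.*2) l ^+ 2 * h / 2 * expwt r (gain_site N j) k ^+ 2)).
    rewrite [leRHS](bigD1 (Ordinal (gain_site_lt jN)))//=; apply: ler_wpDl.
      exact: mulr_ge0 lh0 (sqr_ge0 _).
    apply: ler_sum => k _; have c1 : c b ^+ 2 <= 1.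
      by have /andP[? ?] := c01 b; exact: exprn_ile1.
    have -> : (l * (c b * expwt r (gain_site N j) k)) ^+ 2 * h / 2 =
        l ^+ 2 * h / 2 * expwt r (gain_site N j) k ^+ 2 * c b ^+ 2 by ring.
    by rewrite ler_piMr//; exact: mulr_ge0 lh0 (sqr_ge0 _).
  rewrite -mulr_sumr ler_piMr//.
  by apply: sum_expwt_sqr_le => //; exact/ltnW/gain_site_lt.
rewrite /gain_weight.
pose G (sg : {ffun 'I_N -> bool}) (w : Omega) : R :=
  \prod_(k < N.*2) \prod_(j < N) gain_factor r l h N (ffun_ext sg j) k j
    (B k (tau j.+1) w - B k (tau j) w).
have mG sg : measurable_fun setT (G sg).
  by apply: measurable_prod => k _; apply: measurable_prod => j _; apply: measurableT_comp.
have G0 sg w : 0 <= G sg w.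
  by apply: prodr_ge0 => k _; apply: prodr_ge0 => j _; exact: gain_factor_ge0.
pose S (sg : {ffun 'I_N -> bool}) := \prod_(j < N) gain_shift r l h (sg j).
have S0 sg : 0 <= S sg by apply: prodr_ge0 => j _; exact: gain_shift_ge0.
rewrite (_ : (\int[P]_w _)%E =
  (\sum_(sg : {ffun 'I_N -> bool}) \int[P]_w (S sg * G sg w)%:E)%E); last first.
  rewrite -ge0_integral_sum//.
  - by apply: eq_integral => w _; rewrite sumEFin.
  - by move=> sg; apply/measurable_EFinP; exact: measurable_funM.
  - by move=> sg w _; rewrite lee_fin mulr_ge0.
have EG sg : (\int[P]_w (S sg * G sg w)%:E <=
    (\prod_(j < N) (gain_shift r l h (sg j) * (p_ (sg j) * expR (l ^+ 2 * h / 2))))%:E)%E.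
  under eq_integral do rewrite EFinM.
  rewrite ge0_integralZl//; last 3 first.
  - by apply/measurable_EFinP.
  - by move=> w _; rewrite lee_fin.
  - by rewrite lee_fin.
  have mf' k j : measurable_fun setT (gain_factor r l h N (ffun_ext sg j) k j) by [].
  have := @brownian_block_product _ _ _ P B tau (fun k j => gain_factor r l h N (ffun_ext sg j) k j)
    (fun k j => e (ffun_ext sg j) k j) N.*2 N BB tau0 taul (fun k j => mf _ k j)
    (fun k j y => gain_factor_ge0 _ _ _ _ _ _ _ _) (fun k j => fe _ k j).
  rewrite -/(G sg) => ->; rewrite -EFinM lee_fin [leRHS]big_split/= ler_wpM2l//.
  rewrite exchange_big/=; apply: ler_prod => j _; apply/andP; split.
    by apply: prodr_ge0 => k _; exact: e0.
  by rewrite ffun_extE; exact: colbound.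
apply: le_trans; first by apply: lee_sum => sg _; exact: EG.
rewrite sumEFin lee_fin.
rewrite -(bigA_distr_bigA
  (fun (j : 'I_N) b => gain_shift r l h b * (p_ b * expR (l ^+ 2 * h / 2)))).
rewrite prodr_const card_ord big_bool /= /p_ -piE.
have -> : fine (normal_prob 0 (Num.sqrt h) (gain_set h false)) = 1 - pi_.
  rewrite /gain_set [X in fine X]probability_setC; last exact: (mset true).
  by rewrite fineB ?fin_num_measure// -?piE//; exact: (mset true).
rewrite le_eqVlt; apply/orP; left; apply/eqP; congr (_ ^+ N).
by ring.
Qed.

Lemma measurable_gain_weight (d : measure_display) (Omega : measurableType d) (R : realType)
    (B : nat -> R -> Omega -> R) (r l h T : R) (N : nat) :
  (forall k t, 0 <= t -> measurable_fun setT (B k t)) -> 0 <= T -> 0 <= h ->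
  measurable_fun setT (fun w => gain_weight r l h N
     (fun k j => B k (T + j.+1%:R * h) w - B k (T + j%:R * h) w)).
Proof.
move=> mB T0 h0.
have t0 (j : nat) : 0 <= T + j%:R * h by rewrite addr_ge0// mulr_ge0.
apply: measurable_sum => sg; apply: measurable_funM => //.
apply: measurable_prod => k _; apply: measurable_prod => j _.
apply: (@measurableT_comp _ _ _ _ _ _ (gain_factor r l h N (ffun_ext sg j) k j)).
  apply: measurable_funM.
    apply: measurable_indic; case: ifP => _; last exact: measurableT.
    by rewrite /gain_set; case: ifP => // _; exact: measurableC.
  by apply: measurableT_comp => //; exact: measurable_funM.
by apply: measurable_funB; exact: mB.
Qed.

Lemma descending_gain_ae (d : measure_display) (Omega : measurableType d) (R : realType)
    (P : probability Omega R) (B : nat -> R -> Omega -> R) (r T K : R) :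
  brownian_family P B -> 0 <= T -> 0 <= r -> r < 1 -> 0 <= K ->
  exists2 tau, 0 < tau & \forall w \ae P, exists N0, forall N, (N0 <= N)%N ->
    descending_gain r (fun k t => B k t w) T (tau / N%:R) K N.
Proof.
move=> BB T0 r0 r1 K0; have [sbm _] := BB.
have mB k t : 0 <= t -> measurable_fun setT (B k t) by have [+ _ _ _] := sbm k; apply.
have r01 : 0 <= r <= 1 by rewrite r0 ltW.
pose dl : R := normal_tail R; have dl0 : 0 < dl by exact: normal_tail_gt0.
(* This minimises the exponent e^2 / 2 - dl (1 - r) e / 2 of one block; the minimum is - e^2 / 2. *)
pose e := dl * (1 - r) / 2.
have r1' : 0 < 1 - r by rewrite subr_gt0.
have e0 : 0 < e by rewrite divr_gt0// mulr_gt0.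
(* The gain obtained is (e / 4) sqrt(tau) sqrt N, so sqrt(tau) >= 4 K / e is required; the 1 keeps
   tau positive when K = 0. *)
pose tau := (4 * K / e) ^+ 2 + 1.
have tau0 : 0 < tau by rewrite ltr_wpDl ?sqr_ge0.
exists tau => //.
pose h (N : nat) : R := tau / N%:R.
pose l N := e / Num.sqrt (h N).
have h0 N : 0 < h N.+1 by rewrite divr_gt0// ltr0n.
have sh0 N : 0 < Num.sqrt (h N.+1) by rewrite sqrtr_gt0.
have l0 N : 0 < l N.+1 by rewrite divr_gt0.
pose xi N w (k j : nat) := B k (T + j.+1%:R * h N) w - B k (T + j%:R * h N) w.
(* Half of the decay exp (- N e^2 / 2) pays for summability over N; the other half becomes the
   gain. *)
pose Y n w : \bar R := (expR (n.+1%:R * (e ^+ 2 / 4)) *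
  gain_weight r (l n.+1) (h n.+1) n.+1 (xi n.+1 w))%:E.
have mW n : measurable_fun setT (fun w => gain_weight r (l n.+1) (h n.+1) n.+1 (xi n.+1 w)).
  by apply: measurable_gain_weight => //; exact: ltW.
have W0 n w : 0 <= gain_weight r (l n.+1) (h n.+1) n.+1 (xi n.+1 w).
  apply: sumr_ge0 => s _; rewrite mulr_ge0//.
    by apply: prodr_ge0 => j _; exact: gain_shift_ge0.
  by apply: prodr_ge0 => k _; apply: prodr_ge0 => j _; exact: gain_factor_ge0.
have mY n : measurable_fun setT (Y n).
  by apply/measurable_EFinP; exact: measurable_funM.
have Y0 n w : (0 <= Y n w)%E by rewrite lee_fin mulr_ge0 ?expR_ge0.
pose rho := expR (- (e ^+ 2 / 4)).
have e40 : 0 < e ^+ 2 / 4 by rewrite divr_gt0// exprn_gt0.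
have rho0 : 0 <= rho by exact: expR_ge0.
have rho1 : rho < 1 by rewrite -expR0 ltr_expR oppr_lt0.
have EY n : (\int[P]_w Y n w <= (rho * rho ^+ n)%:E)%E.
  rewrite /Y; under eq_integral do rewrite EFinM.
  rewrite ge0_integralZl//; last 2 first.
  - by apply/measurable_EFinP; exact: mW.
  - by move=> w _; rewrite lee_fin.
  pose pi_ := fine (normal_prob 0 (Num.sqrt (h n.+1)) (gain_set (h n.+1) true)).
  have EW := @gain_weight_expectation _ _ _ P B r (l n.+1) (h n.+1) T
    pi_ n.+1 BB T0 (h0 n) r01 erefl.
  apply: le_trans; first by apply: lee_wpmul2l EW; rewrite lee_fin expR_ge0.
  have piE : (pi_%:E = normal_prob 0 (Num.sqrt (h n.+1)) (gain_set (h n.+1) true))%E.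
    by rewrite fineK//; apply: fin_num_measure; exact: measurable_itv.
  have dlpi : dl <= pi_.
    by rewrite -lee_fin piE; exact: normal_tail_le.
  have pi1 : pi_ <= 1.
    by rewrite -lee_fin piE; apply: probability_le1; exact: measurable_itv.
  have lh : l n.+1 ^+ 2 * h n.+1 = e ^+ 2.
    rewrite /l expr_div_n sqr_sqrtr ?divfK// ?gt_eqF// ltW//.
  have ls : l n.+1 * ((1 - r) * Num.sqrt (h n.+1)) = e * (1 - r).
    by rewrite /l; field; rewrite gt_eqF.
  have dl1 : dl <= 1 := le_trans dlpi pi1.
  have er1 : e * (1 - r) <= 1.
    have h1 : (1 - r) * (1 - r) <= 1 by apply: mulr_ile1; rewrite ?(ltW r1')// gerBl.
    have : dl * ((1 - r) * (1 - r)) <= 1.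
      by apply: mulr_ile1 => //; rewrite ?mulr_ge0 ?(ltW r1') ?(ltW dl0).
    have -> : e * (1 - r) = dl * ((1 - r) * (1 - r)) / 2 by rewrite /e; ring.
    by move=> ?; lra.
  have er0 : 0 <= e * (1 - r) by apply: mulr_ge0; exact: ltW.
  rewrite -EFinM lee_fin lh ls.
  have F := exp_gain_factor_le (e ^+ 2 / 2) (ltW dl0) dlpi pi1 er0 er1.
  have eE : e ^+ 2 / 2 - dl * (e * (1 - r)) / 2 = - (e ^+ 2 / 2).
    have -> : dl * (e * (1 - r)) / 2 = e * e by rewrite /e; ring.
    by rewrite expr2; field.
  rewrite eE in F.
  apply: (@le_trans _ _ (expR (n.+1%:R * (e ^+ 2 / 4)) * expR (- (e ^+ 2 / 2)) ^+ n.+1)).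
    rewrite ler_wpM2l ?expR_ge0// lerXn2r ?nnegrE ?expR_ge0// mulr_ge0 ?expR_ge0//.
    by rewrite addr_ge0 ?subr_ge0// mulr_ge0 ?expR_ge0// (le_trans _ dlpi)// ltW.
  rewrite -expRM_natl -expRD -exprS -expRM_natl ler_expR.
  by rewrite le_eqVlt; apply/orP; left; apply/eqP; field.
apply: filterS (summable_expectation_ae rho0 rho1 mY Y0 EY) => w [n0 H].
exists n0.+1 => N; case: N => // n; rewrite ltnS => n0n.
have [m [mm m0 Hm]] := @gain_weight_path _ r (l n.+1) (h n.+1) n.+1
  (xi n.+1 w) r01 (ltW (l0 n)) (ltn0Sn n).
exists m; split => //.
have := H n n0n; rewrite /Y lte_fin => Yn.
have : expR (n.+1%:R * (e ^+ 2 / 4)) *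
  expR (l n.+1 * \sum_(j < n.+1) expavg r (fun k => xi n.+1 w k j) (m j)) < 1.
  by apply: le_lt_trans Yn; rewrite ler_wpM2l ?expR_ge0.
rewrite -expRD -[X in _ < X]expR0 ltr_expR.
have -> : \sum_(j < n.+1) expavg r (fun k => xi n.+1 w k j) (m j) =
   \sum_(j < n.+1) (expavg r (fun k => B k (T + j.+1%:R * h n.+1) w) (m j)
     - expavg r (fun k => B k (T + j%:R * h n.+1) w) (m j)).
  by apply: eq_bigr => j _; rewrite -expavgB.
set G := \sum_(j < n.+1) _ => Glt.
have GN : G <= - (n.+1%:R * (e / 4) * Num.sqrt (h n.+1)).
  rewrite -(ler_pM2l (l0 n)).
  have -> : l n.+1 * - (n.+1%:R * (e / 4) * Num.sqrt (h n.+1)) = - (n.+1%:R * (e ^+ 2 / 4)).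
    by rewrite /l; field; rewrite gt_eqF.
  by move: Glt; clear; lra.
apply: le_trans GN _; rewrite mulNr lerN2.
have sn0 : 0 < Num.sqrt n.+1%:R :> R by rewrite sqrtr_gt0 ltr0n.
have -> : n.+1%:R * (e / 4) * Num.sqrt (h n.+1) = (e / 4 * Num.sqrt tau) * Num.sqrt n.+1%:R.
  rewrite /h sqrtrM ?(ltW tau0)// sqrtrV// -{1}(@sqr_sqrtr _ (n.+1%:R : R))//.
  by field; rewrite gt_eqF.
rewrite ler_wpM2r ?(ltW sn0)//.
have : 4 * K / e <= Num.sqrt tau.
  have k0 : 0 <= 4 * K / e by rewrite divr_ge0 ?mulr_ge0// ltW.
  by rewrite -(ger0_norm k0) -sqrtr_sqr ler_sqrt ?(ltW tau0)// lerDl.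
by rewrite ler_pdivrMr//; clear; lra.
Qed.

(** * Pathwise uniqueness *)

Lemma limn_esup0_lt (R : realType) (u : nat -> \bar R) (e : R) : 0 < e ->
  limn_esup u = 0%E -> exists M0 : nat, forall M, (M0 <= M)%N -> (u M < e%:E)%E.
Proof.
move=> e0; rewrite limn_esup_lim => u0.
have : (ereal_inf (range (esups u)) < e%:E)%E.
  by rewrite -(cvg_lim _ (@cvg_esups_inf _ u))// u0 lte_fin.
move=> /ereal_inf_lt[_ [M0 _ <-] HM]; exists M0 => M MM.
apply: le_lt_trans HM; apply: ereal_sup_ubound.
by exists M.
Qed.

(** The exceptional set in (LT) depends on T; integer horizons are countably many, and monotonicity
    of the local times in time covers the others. *)
Lemma LT_vanishing_left_flux (d : measure_display) (Omega : measurableType d) (R : realType)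
    (P : probability Omega R) (F : R -> set (set Omega)) (p q : R) x B X L :
  0 < p -> 0 < q -> solution P F p q x B X L -> LT p q P X L ->
  \forall w \ae P, vanishing_left_flux (p / q) (fun i t => L i t w).
Proof.
move=> p0 q0 [_ _ sol] lt.
have Hk : \forall w \ae P, forall k : nat,
    limn_esup (fun M : nat => ((q / p) ^- M * L (- M%:Z) k%:R w)%:E) = 0%E.
  by apply: ae_foralln => k; exact: lt.
apply: filterS (filterI sol Hk) => w [[_ _ _ con] Hw] T e T0 e0.
have [M0 HM] := limn_esup0_lt e0 (Hw (Num.truncn T).+1).
exists M0 => M MM; have := HM M MM; rewrite lte_fin; apply: le_lt_trans.
have -> : (p / q) ^+ M = (q / p) ^- M by rewrite -exprVn invf_div.
rewrite ler_wpM2l ?invr_ge0 ?exprn_ge0 ?divr_ge0 ?(ltW p0) ?(ltW q0)//.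
have [mon _ _] := con (- M%:Z); apply: mon => //.
exact/ltW/truncnS_gt.
Qed.

Lemma ae_forall_int (d : measure_display) (T : measurableType d) (R : realType)
    (mu : {measure set T -> \bar R}) (Q : int -> T -> Prop) :
  (forall n, \forall w \ae mu, Q n w) -> \forall w \ae mu, forall n, Q n w.
Proof.
move=> H; have H1 := ae_foralln (fun k => H k%:Z); have H2 := ae_foralln (fun k => H (Negz k)).
by apply: filterS (filterI H1 H2) => w [h1 h2] [k|k]; [exact: h1|exact: h2].
Qed.

(** Equal positions give q (L_i - L'_i) = p (L_(i-1) - L'_(i-1)). After k steps to the left the
    difference carries the factor (p / q)^k, which (LT) for both solutions sends to 0. *)
Lemma local_times_eq (R : realType) (p q : R) x (B X L X' L' : int -> R -> R) (t : R) :
  0 < p -> 0 < q -> p < q ->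
  solution_path p q x B X L -> solution_path p q x B X' L' ->
  vanishing_left_flux (p / q) L -> vanishing_left_flux (p / q) L' ->
  0 <= t -> (forall i, X i t = X' i t) -> forall i, L i t = L' i t.
Proof.
move=> p0 q0 pq sol sol' V V' t0 XX i.
have r0 : 0 < p / q by rewrite divr_gt0.
have r1 : p / q < 1 by rewrite ltr_pdivrMr// mul1r.
have L0 := local_time_ge0 sol; have L'0 := local_time_ge0 sol'.
have step j : L j t - L' j t = p / q * (L (j - 1) t - L' (j - 1) t).
  have [_ e _ _] := sol; have [_ e' _ _] := sol'.
  have := XX j; rewrite e// e'// => /eqP; rewrite -subr_eq0 => /eqP h.
  have q1 : q != 0 by rewrite gt_eqF.
  apply: (mulfI q1); rewrite mulrA [q * (p / q)]mulrC divfK//.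
  by move: h; clear; lra.
have iter k : L i t - L' i t = (p / q) ^+ k * (L (i - k%:Z) t - L' (i - k%:Z) t).
  elim: k => [|k ->]; first by rewrite expr0 mul1r subr0.
  by rewrite step subzBr1 exprSr mulrA.
apply/eqP; rewrite -subr_eq0 -normr_le0; apply/ler_addgt0Pr => e e0; rewrite add0r.
have [M1 H1] := vanishing_left_flux_shift r0 r1 L0 V i t0 e0.
have [M2 H2] := vanishing_left_flux_shift r0 r1 L'0 V' i t0 e0.
rewrite (iter (M1 + M2)%N).
have := H1 _ (leq_addr M2 M1); have := H2 _ (leq_addl M1 M2).
set c := (p / q) ^+ _; have c0 : 0 <= c by rewrite exprn_ge0// ltW.
have := mulr_ge0 c0 (L0 (i - (M1 + M2)%:Z) t t0).
have := mulr_ge0 c0 (L'0 (i - (M1 + M2)%:Z) t t0).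
rewrite mulrBr ler_norml; move: (c * _) (c * _) => a b.
by clear=> *; apply/andP; split; lra.
Qed.

Theorem theorem2p2 (R : realType) (p q : R) (gamma : probability (seqR R) R) :
  p = 1 - q -> 0 < p -> p < 1 / 2 ->
  P0 gamma ->
  (\forall x \ae gamma,
     limn_esup (fun M : nat => (- x (- M%:Z) / Num.sqrt M%:R)%:E) = +oo%E) ->
  pathwise_unique p q gamma (@LT R p q).
Proof.
move=> pE p0 p2 _ _ d Omega P F B x _ indep _ _ _ X L X' L' sol lt sol' lt'.
have pq : p < q by lra.
have q0 : 0 < q by exact: lt_trans pq.
have r0 : 0 <= p / q by rewrite divr_ge0// ltW.
have r1 : p / q < 1 by rewrite ltr_pdivrMr// mul1r.
have V := LT_vanishing_left_flux p0 q0 sol lt.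
have V' := LT_vanishing_left_flux p0 q0 sol' lt'.
have [_ _ path] := sol; have [_ _ path'] := sol'.
pose C (k : nat) : R := 70 * Num.sqrt k.+1%:R.
have C0 k : 0 <= C k by rewrite mulr_ge0 ?sqrtr_ge0.
(* Countably many sites and integer horizons share one null set. *)
have noise : \forall w \ae P, forall (n : int) (k : nat),
    (exists N0, forall N, (N0 <= N)%N ->
       path_noise_bounded (fun j t => B (n + j%:Z) t w) k.+1%:R (C k) N) /\
    (exists2 tau, 0 < tau & exists N0, forall N, (N0 <= N)%N ->
       descending_gain (p / q) (fun j t => B (n + j%:Z) t w) k.+1%:R (tau / N%:R) (4 * C k + 1) N).
  apply: ae_forall_int => n; apply: ae_foralln => k.
  have BB := brownian_family_shift n indep.
  have T0 : 0 < k.+1%:R :> R by rewrite ltr0n.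
  have K0 : 0 <= 4 * C k + 1 by rewrite addr_ge0// mulr_ge0.
  have [tau tau0 G] := descending_gain_ae BB (ltW T0) r0 r1 K0.
  by apply: filterS (filterI (path_noise_ae BB T0) G) => w [H1 H2]; split => //; exists tau.
apply: filterS (filterI (filterI path path') (filterI (filterI V V') noise)) => w.
move=> [[{}path {}path'] [[{}V {}V'] {}noise]].
have XX i t : 0 <= t -> X i t w = X' i t w.
  move=> t0; pose k := Num.truncn t.
  have tk : 0 <= t <= k.+1%:R by rewrite t0; exact/ltW/truncnS_gt.
  have [H1 H2] := noise i k.
  (* Each inequality uses (LT) for the solution on its left-hand side. *)
  apply/eqP; rewrite eq_le; apply/andP; split.
    exact: (no_discrepancy q0 p0 pq (C0 k) path path' V H1 H2).
  exact: (no_discrepancy q0 p0 pq (C0 k) path' path V' H1 H2).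
move=> i t t0; split; first exact: XX.
apply: (local_times_eq p0 q0 pq path path' V V' t0) => j.
exact: XX.
Qed.
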